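(* Let $(\mathcal S,d,\mu)$ be a space of homogeneous type with quasimetric constant $\kappa$ and doubling order $D_\mu$. Let $w\in A_\infty$ and define $$r(w)=1+\frac{1}{\tau_{\kappa\mu}[w]_{A_\infty}},\qquad \tau_{\kappa\mu}:=6\left(32\kappa^2(4\kappa^2+\kappa)^2\right)^{D_\mu}.$$ Then for every ball $B$ in $\mathcal S$, $$\left(\frac{1}{\mu(B)}\int_B w^{r(w)}\,d\mu\right)^{1/r(w)}\le 2(4\kappa)^{D_\mu}\,\frac{1}{\mu(2\kappa B)}\int_{2\kappa B} w\,d\mu .$$
   Context: A quasimetric on a set $\mathcal S$ is a function $d:\mathcal S\times\mathcal S\to[0,\infty)$ with $d(x,y)=0$ iff $x=y$, $d(x,y)=d(y,x)$, and $d(x,y)\le\kappa(d(x,z)+d(z,y))$ for all $x,y,z$, for some finite constant $\kappa\ge1$ (the quasimetric constant). Balls are $B(x,r)=\{y\in\mathcal S: d(x,y)<r\}$, $r>0$; each ball carries its center and radius, and for $B=B(x,r)$ and $\lambda>0$, $\lambda B=B(x,\lambda r)$. A space of homogeneous type $(\mathcal S,d,\mu)$ is a set with a quasimetric $d$ and a nonnegative Borel measure $\mu$ such that $\mu(B(x,2r))\le C\mu(B(x,r))$ for all $x\in\mathcal S$, $r>0$. $C_\mu$ denotes the smallest such constant and $D_\mu=\log_2 C_\mu$ is the doubling order. Standing assumptions: $0<\mu(B)<\infty$ for every ball $B$; $d$ is continuous and balls are open; the Lebesgue differentiation theorem holds on $(\mathcal S,d,\mu)$. A weight is a nonnegative measurable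 function on $\mathcal S$. For $1<p<\infty$, $w\in A_p$ means $$[w]_{A_p}:=\sup_B\left(\frac1{\mu(B)}\int_B w\,d\mu\right)\left(\frac1{\mu(B)}\int_B w^{-\frac1{p-1}}\,d\mu\right)^{p-1}<\infty,$$ the supremum being over all balls in $\mathcal S$ (with the convention $0\cdot\infty=\infty$, so that $A_p$ weights are locally integrable and a.e. positive), and $A_\infty:=\bigcup_{p>1}A_p$. The uncentered Hardy-Littlewood maximal operator is $Mf(x)=\sup_{B\ni x}\frac1{\mu(B)}\int_B|f|\,d\mu$ (supremum over balls $B$ containing $x$). With $w(B)=\int_B w\,d\mu$, the $A_\infty$ constant is $$[w]_{A_\infty}:=\sup_B\frac1{w(B)}\int_B M(w\chi_B)\,d\mu .$$ *)

(* Defs.v *)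
From HB Require Import structures.
From mathcomp Require Import all_boot all_order all_algebra.
From mathcomp Require Import all_classical all_reals all_analysis.

Set Implicit Arguments.
Unset Strict Implicit.
Unset Printing Implicit Defensive.

Import Order.TTheory GRing.Theory Num.Theory.
Import numFieldNormedType.Exports.

Local Open Scope classical_set_scope.
Local Open Scope ring_scope.

Notation borel S := (g_sigma_algebraType (@open S)).

Section HomogeneousType.
Context {R : realType} {S : ptopologicalType}.
Implicit Types (d : S -> S -> R) (kappa : R)
  (mu : {measure set (borel S) -> \bar R}).

Record is_quasimetric kappa d : Prop := {
  quasimetric_const : 1 <= kappa ;
  quasimetric_ge0 : forall x y, 0 <= d x y ;
  quasimetric_eq0 : forall x y, d x y = 0 <-> x = y ;
  quasimetric_sym : forall x y, d x y = d y x ;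
  quasimetric_triangle :
    forall x y z, d x y <= kappa * (d x z + d z y) }.

(* A ball carries its center and its radius: statements about balls quantify
   over x and r > 0, and the dilate lambda B is qball d x (lambda * r). *)
Definition qball d (x : S) (r : R) : set S := [set y | d x y < r].

(* The topology of S, hence [borel S], is the one induced by d. *)
Definition induces_topology d : Prop :=
  forall U : set S,
    open U <-> forall x, U x -> exists2 r, 0 < r & qball d x r `<=` U.

Definition doubling_bound d mu (C : R) : Prop :=
  forall (x : S) (r : R), 0 < r -> (mu (qball d x (2 * r)) <= C%:E * mu (qball d x r))%E.

Definition doubling_const d mu : R := inf [set C | doubling_bound d mu C].

Definition doubling_order d mu : R := ln (doubling_const d mu) / ln 2.

Record is_homogeneous_type kappa d mu : Prop := {
  homogeneous_quasimetric : is_quasimetric kappa d ;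
  homogeneous_topology : induces_topology d ;
  homogeneous_doubling : exists C : R, doubling_bound d mu C }.

Definition average mu (A : set S) (f : S -> \bar R) : \bar R :=
  ((mu A)^-1 * \int[mu]_(y in A) f y)%E.

Definition averages_differentiate d mu : Prop :=
  forall f : S -> R,
    (forall (x : S) (r : R), 0 < r -> mu.-integrable (qball d x r) (EFin \o f)) ->
    {ae mu, forall x,
      average mu (qball d x r) (EFin \o f) @[r --> 0^'+] --> (f x)%:E}.

Record standing_assumptions d mu : Prop := {
  ball_measure_gt0 : forall (x : S) (r : R), 0 < r -> (0 < mu (qball d x r))%E ;
  ball_measure_lty : forall (x : S) (r : R), 0 < r -> (mu (qball d x r) < +oo)%E ;
  quasimetric_continuous : continuous (fun z : S * S => d z.1 z.2) ;
  ball_open : forall (x : S) (r : R), 0 < r -> open (qball d x r) ;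
  differentiation : averages_differentiate d mu }.

End HomogeneousType.

Section Weights.
Context {R : realType} {S : ptopologicalType}.
Variables (d : S -> S -> R) (mu : {measure set (borel S) -> \bar R}).
Implicit Types w : S -> R.
Local Open Scope ereal_scope.

Definition is_weight w : Prop :=
  (forall x, 0 <= w x)%R /\ measurable_fun [set: borel S] (w : borel S -> R).

(* Product on [0, +oo] with 0 * +oo = +oo, whereas [mule] has 0 * +oo = 0. *)
Definition mul0y (x y : \bar R) : \bar R :=
  if ((x == 0) && (y == +oo)) || ((x == +oo) && (y == 0)) then +oo else x * y.

(* The power w^(-1/(p-1)) is written with the inverse of \bar R, so that it is
   +oo where w vanishes; [powR] alone would give 0 there. *)
Definition Ap_const (p : R) w : \bar R :=
  ereal_sup [set a | exists (x : S) (r : R), (0 < r)%R /\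
    a = mul0y (average mu (qball d x r) (EFin \o w))
          (average mu (qball d x r)
             (fun y => ((w y)%:E `^ (p - 1)^-1)^-1) `^ (p - 1))].

Definition Ap (p : R) w : Prop := is_weight w /\ Ap_const p w < +oo.

Definition Ainfty w : Prop := exists2 p : R, (1 < p)%R & Ap p w.

Definition maximal_fun (f : S -> R) (x : S) : \bar R :=
  ereal_sup [set a | exists (z : S) (r : R), [/\ (0 < r)%R, qball d z r x &
    a = average mu (qball d z r) (fun y => `|(f y)%:E|)]].

Definition wmeasure w (A : set S) : \bar R := \int[mu]_(y in A) (w y)%:E.

Definition Ainfty_const w : \bar R :=
  ereal_sup [set a | exists (x : S) (r : R), (0 < r)%R /\
    a = (wmeasure w (qball d x r))^-1 *
        \int[mu]_(y in qball d x r)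
          maximal_fun (fun z => w z * \1_(qball d x r) z)%R y].

Definition tau (kappa : R) : R :=
  (6 * (32 * kappa ^+ 2 * (4 * kappa ^+ 2 + kappa) ^+ 2)
         `^ doubling_order d mu)%R.

(* The reciprocal is taken in \bar R, since [Ainfty_const w] is an extended
   real; its value is a nonnegative real number. *)
Definition rh_exponent (kappa : R) w : R :=
  (1 + fine (((tau kappa)%:E * Ainfty_const w)^-1)%E)%R.

End Weights.

(* Main.v *)
Require Import Defs.
From HB Require Import structures.
From mathcomp Require Import all_boot all_order all_algebra.
From mathcomp Require Import all_classical all_reals all_analysis.
From mathcomp Require Import measurable_realfun ring lra.

Set Implicit Arguments.
Unset Strict Implicit.
Unset Printing Implicit Defensive.

Import Order.TTheory GRing.Theory Num.Theory.
Import numFieldNormedType.Exports.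

Local Open Scope classical_set_scope.
Local Open Scope ring_scope.

(** Let B = B(x, r) and Q = 2 kappa B, and let M be the maximal function of w
    over the local balls, those with center in B and radius at most r; they all
    lie in Q. By Lebesgue differentiation w <= M almost everywhere on B, so it
    is enough to bound the integral of M^e w over Q, with
    e = 1 / (tau [w]_{A_infty}).

    Two estimates on the superlevel sets {M > la}, valid as soon as la exceeds
    a multiple l0 of the average of w over Q, give this bound:
      w({M > la}) <= P la mu({M > la})                    (a)
      int_{M > la} M <= 2 P [w]_{A_infty} la mu({M > la})  (b)
    where tau = 6 P. Both come from a Vitali selection ([vitali_selection],
    [ge0_integral_le_cover]) among the [stopped] balls: local balls on which w
    has average above la, of radius within a factor 2 of the largest possible
    at one of their points. A dilate of a stopped ball by more than 2 has
    average at most la, up to doubling, which gives (a). For (b), the local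
    balls through a point of an enlarged stopped ball are of two kinds
    ([local_maximal_near_stopped]): the large ones have average at most a
    multiple of la by stopping, the small ones stay in a fixed dilate tB of the
    stopped ball. Hence M is controlled there by M(w 1_{tB}), whose integral
    over tB is at most [w]_{A_infty} w(tB): this is where the hypothesis on the
    weight enters.

    Summing (b) against the increments of la^e ([ge0_integral_step_power])
    bounds int M^(1+e) by a main term plus a multiple of itself, and the size
    of e makes this multiple 1/2, so that it can be absorbed. Truncation to
    finitely many levels makes the absorbed quantity finite. Summing (a) in the
    same way then bounds int M^e w by (3/2) l0^e w(Q), and l0^e exceeds the
    e-th power of the average of w over Q by a factor of at most 7/6, since e
    is small compared with the constant in l0. When [w]_{A_infty} is infinite
    the exponent is 1 and doubling alone suffices. *)

(** * Disjoint families and the Vitali selection *)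

(** Only finitely many disjoint sets of mass above [1 / (n + 1)] fit in Q. *)
Lemma trivIset_gt0_countable {dd : measure_display} {T : measurableType dd}
    {R : realType} (mu : {measure set T -> \bar R}) {I : pointedType}
    (G : set I) (F : I -> set T) (Q : set T) :
    (forall i, G i -> measurable (F i)) -> trivIset G F ->
    (forall i, G i -> F i `<=` Q) -> measurable Q -> (mu Q < +oo)%E ->
    (forall i, G i -> (0 < mu (F i))%E) -> countable G.
Proof.
move=> mF tF FQ mQ Qoo Fgt0.
have leQ A : measurable A -> A `<=` Q -> (mu A <= mu Q)%E.
  by move=> mA AQ; apply: le_measure => //; rewrite inE.
have Ffin i : G i -> mu (F i) \is a fin_num.
  move=> Gi; rewrite ge0_fin_numE//; apply: le_lt_trans Qoo.
  by apply: leQ; [exact: mF|exact: FQ].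
have -> : G = \bigcup_n (G `&` [set i | n.+1%:R^-1 < fine (mu (F i))]).
  apply/seteqP; split=> [i Gi|i [n _ []]//].
  have : 0 < fine (mu (F i)).
    by rewrite fine_gt0// Fgt0//= -ge0_fin_numE// Ffin.
  by move=> /ltr_add_invr[k]; rewrite add0r => ?; exists k.
apply: bigcup_countable => // n _; apply: finite_set_countable.
apply: contrapT => /infiniteP/pcard_leP/injfunPex[/= q q_fun q_inj].
have GQ k : G (q k) by have [] := q_fun k Logic.I.
have tq : trivIset setT (F \o q).
  rewrite trivIset_comp//; apply: sub_trivIset tF => _ [k _ <-]; exact: GQ.
set V := \bigcup_k F (q k).
have mV : measurable V by apply: bigcup_measurable => k _; exact/mF.
have VQ : V `<=` Q by move=> x [k _]; apply: FQ.
have /leQ/(_ VQ) muVQ := mV.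
have Qfin : mu Q \is a fin_num by rewrite ge0_fin_numE.
pose N := Num.bound (fine (mu Q) * n.+1%:R).
have : (fine (mu Q) < N%:R / n.+1%:R)%R.
  rewrite ltr_pdivlMr//; apply: archi_boundP.
  by rewrite mulr_ge0// fine_ge0.
apply/negP; rewrite -leNgt -lee_fin fineK//; apply: le_trans muVQ.
rewrite /V measure_bigcup//; last by move=> k _; exact/mF.
apply: le_trans (nneseries_lim_ge N _) => //.
have -> : N%:R / n.+1%:R = (\sum_(0 <= k < N) n.+1%:R^-1 :> R)%R.
  by rewrite sumr_const_nat subn0 mulr_natl.
rewrite -sumEFin.
rewrite [leRHS](eq_bigl xpredT); last by move=> k; rewrite in_setT.
apply: lee_sum => k _; have [_ /ltW] := q_fun k Logic.I.
by rewrite -lee_fin fineK// Ffin.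
Qed.

(** The form in which a covering is used: F is the selected disjoint family and
    E its enlargements. Disjointness makes the local bounds add up to a single
    multiple of [mu Q], and it makes G countable, so that there is a sum to
    speak of. *)
Lemma ge0_integral_le_cover {dd : measure_display} {T : measurableType dd}
    {R : realType} (mu : {measure set T -> \bar R}) {I : pointedType}
    (G : set I) (F E : I -> set T) (A Q : set T) (g : T -> \bar R) (c : R) :
    (forall i, G i -> measurable (F i)) -> trivIset G F ->
    (forall i, G i -> F i `<=` Q) -> measurable Q -> (mu Q < +oo)%E ->
    (forall i, G i -> (0 < mu (F i))%E) ->
    measurable A -> (forall i, G i -> measurable (E i)) ->
    A `<=` \bigcup_(i in G) E i ->
    measurable_fun [set: T] g -> (forall x, 0 <= g x)%E -> 0 <= c ->
    (forall i, G i -> \int[mu]_(x in E i `&` A) g x <= c%:E * mu (F i))%E ->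
  (\int[mu]_(x in A) g x <= c%:E * mu Q)%E.
Proof.
move=> mF tF FQ mQ Qoo Fgt0 mA mE AE mg g0 c0 gF.
have /countable_bijP[D] := trivIset_gt0_countable mF tF FQ mQ Qoo Fgt0.
rewrite card_eq_sym => /pcard_eqP/bijPex[/= h [hfun hinj hsurj]].
have DG k : k \in D -> G (h k) by rewrite inE => Dk; exact: hfun.
pose u k : T -> \bar R :=
  if k \in D then g \_ (E (h k)) else cst 0%E.
have u0 k x : (0 <= u k x)%E.
  by rewrite /u; case: ifPn => // _; rewrite patchE; case: ifPn.
have mu_ k : measurable_fun A (u k).
  rewrite /u; case: ifPn => // /DG Gk; apply: measurable_funTS.
  by apply/(measurable_restrictT _ _).1; [exact: mE|exact: measurable_funTS].
have gu x : A x -> (g x <= \sum_(0 <= k <oo) u k x)%E.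
  move=> /AE[i Gi Ex]; have [k Dk hk] := hsurj i Gi.
  apply: le_trans (nneseries_lim_ge k.+1 _) => //.
  rewrite big_nat_recr//=; apply: le_trans (leeDr _ _); last first.
    exact: sume_ge0.
  by rewrite /u mem_set// patchE hk mem_set.
have le1 : (\int[mu]_(x in A) g x <= \sum_(0 <= k <oo) \int[mu]_(x in A) u k x)%E.
  rewrite -integral_nneseries//; apply: ge0_le_integral => //.
  - exact: measurable_funTS.
  - by apply: ge0_emeasurable_sum => // k _; exact: mu_.
apply: (le_trans le1).
have Qsub : (\sum_(0 <= k <oo | k \in D) mu (F (h k)) <= mu Q)%E.
  rewrite -measure_bigcup//; first last.
  - by rewrite trivIset_comp//; apply: sub_trivIset tF => _ [k /hfun ? <-].
  - by move=> k /hfun /mF.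
  apply: le_measure => //; rewrite ?inE//.
    by apply: bigcup_measurable => k /hfun /mF.
  by move=> x [k /hfun Gk]; exact: FQ.
apply: (@le_trans _ _ (c%:E * \sum_(0 <= k <oo | k \in D) mu (F (h k)))%E); last first.
  exact: lee_wpmul2l.
rewrite -nneseriesZl// [leRHS]eseries_mkcond; apply: lee_nneseries => // [k _ _|k _].
  exact: integral_ge0.
rewrite /u; case: ifPn => [kD|_]; last by rewrite integral0.
by rewrite -integral_mkcondr setIC; exact/gF/DG.
Qed.

Lemma ae_imply {dd : measure_display} {T : measurableType dd} {R : realType}
    (mu : {measure set T -> \bar R}) (P Q : T -> Prop) :
  (forall x, P x -> Q x) -> {ae mu, forall x, P x} -> {ae mu, forall x, Q x}.
Proof. by move=> PQ; apply: filterS. Qed.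

(** Zorn's lemma replaces the greedy choice: G is maximal among the disjoint
    subfamilies that dominate in size, up to a factor 2, whatever they meet. *)
Lemma vitali_selection {T I : Type} {R : realType} (F : set I)
    (U : I -> set T) (rad : I -> R) (M : R) :
    (forall i, F i -> U i !=set0) ->
    (forall i, F i -> 0 < rad i) -> (forall i, F i -> rad i <= M) ->
  exists G : set I, [/\ G `<=` F, trivIset G U &
    forall i, F i -> exists2 j, G j & U i `&` U j !=set0 /\ rad i <= 2 * rad j].
Proof.
move=> Fne F0 FM.
pose hit (G : set I) i := exists2 j, G j & U i `&` U j !=set0.
pose P (G : set I) := [/\ G `<=` F, trivIset G U &
  forall i, F i -> hit G i ->
    exists2 j, G j & U i `&` U j !=set0 /\ rad i <= 2 * rad j].
have [|G [[GF tG Gdom] Gmax]] := @Zorn_bigcup I P.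
  move=> C CP Ctot; split.
  - by move=> i [X /CP[XF _ _] /XF].
  - move=> i j [X CX Xi] [Y CY Yj]; have [XY|YX] := Ctot _ _ CX CY.
    + by have [_ tY _] := CP _ CY; apply: tY => //; exact: XY.
    + by have [_ tX _] := CP _ CX; apply: tX => //; exact: YX.
  - move=> i Fi [j [X CX Xj] ij]; have [_ _ Xdom] := CP _ CX.
    by have [|k Xk Hk] := Xdom i Fi; [exists j|exists k => //; exists X].
exists G; split=> // i Fi; apply: (Gdom) => //; apply: contrapT => nhit.
(* Among the members of F missed by G, one of more than half the largest size
   could be added to G. *)
pose F' := [set k | F k /\ ~ hit G k].
pose Z := rad @` F'.
have Zsup : has_sup Z.
  split; first by exists (rad i), i.
  by exists M => _ [k [Fk _] <-]; exact: FM.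
have supZ0 : 0 < sup Z.
  apply: (@lt_le_trans _ _ (rad i)); first exact: F0.
  by apply: sup_upper_bound => //; exists i.
have halfZ : 0 < sup Z / 2 by rewrite divr_gt0.
have [_ [k [Fk nk] <-] lek] := sup_adherent halfZ Zsup.
have lk k' : F' k' -> rad k' <= 2 * rad k.
  move=> F'k'; have : rad k' <= sup Z by apply: sup_upper_bound => //; exists k'.
  by move: lek; lra.
apply: (Gmax (G `|` [set k])).
  split; first exact: subsetUl.
  move=> /(_ k (or_intror erefl)) Gk; apply: nk; exists k => //.
  by rewrite setIid; exact: Fne.
split.
- by move=> j [/GF//|->].
- move=> a b [Ga|->] [Gb|->] //; first exact: tG.
  + by move=> ab; exfalso; apply: nk; exists a => //; rewrite setIC.
  + by move=> ab; exfalso; apply: nk; exists b.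
- move=> a Fa ha; have [hGa|nGa] := pselect (hit G a).
    by have [j Gj Hj] := Gdom a Fa hGa; exists j => //; left.
  case: ha => j [Gj|->] aj; first by exfalso; apply: nGa; exists j.
  by exists k; [right|split => //; exact: lk].
Qed.

(** * Powers as sums over geometric levels *)

Section Layers.
Context {R : realType}.
Implicit Types (x l rho e w : R) (v : \bar R) (k N : nat).

(** The tangent bound [ln y <= y - 1] at [x / u] and [1 / u], with weights [e]
    and [1 - e], where [u] is the right-hand side. *)
Lemma bernoulli_powR x e : 0 < x -> 0 <= e <= 1 -> x `^ e <= 1 + e * (x - 1).
Proof.
move=> x0 /andP[e0 e1].
have u0 : 0 < 1 + e * (x - 1).
  have [->|en1] := eqVneq e 1; first by rewrite mul1r; lra.
  have e_lt1 : 0 < 1 - e by rewrite subr_gt0 lt_neqAle en1.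
  have : 0 <= e * x by rewrite mulr_ge0// ltW.
  by lra.
set u := 1 + e * (x - 1) in u0 *.
have lnB y : 0 < y -> ln y - ln u <= y / u - 1.
  move=> y0; rewrite -ln_div ?posrE//.
  have := @le_ln1Dx R (y / u - 1); rewrite (addrC 1) subrK; apply.
  by rewrite ltrBrDl subrr divr_gt0.
rewrite -ler_ln ?posrE ?powR_gt0// ln_powR.
have h1 := ler_wpM2l e0 (lnB x x0).
have e1' : 0 <= 1 - e by rewrite subr_ge0.
have h2 := ler_wpM2l e1' (lnB 1 ltr01).
have h3 : e * (x / u - 1) + (1 - e) * (1 / u - 1) = 0.
  have -> : e * (x / u - 1) + (1 - e) * (1 / u - 1) = u / u - 1.
    by rewrite /u; ring.
  by rewrite divff ?subrr// gt_eqF.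
by move: h1 h2 h3; rewrite ln1; lra.
Qed.

Definition level l rho k : R := l * rho ^+ k.

(** The number v, rounded up to the next level and capped at [level l rho N],
    raised to the power e, and written as the sum of its jumps. Only comparisons
    with v occur, so that v may be infinite, and the cap keeps every integral of
    such a power finite. *)
Definition step_power l rho e N v : R :=
  l `^ e + \sum_(k < N) (level l rho k.+1 `^ e - level l rho k `^ e)
                        * ((level l rho k)%:E < v)%E%:R.

Section fixed_levels.
Variables (l rho e : R).
Hypotheses (l0 : 0 < l) (rho1 : 1 < rho) (e01 : 0 <= e <= 1).
Local Notation L := (level l rho).
Local Notation phi := (step_power l rho e).

Let rho0 : 0 < rho. Proof. exact: lt_trans rho1. Qed.
Let e0 : 0 <= e. Proof. by case/andP: e01. Qed.

Lemma level_gt0 k : 0 < L k. Proof. by rewrite mulr_gt0// exprn_gt0. Qed.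

Lemma levelS k : L k.+1 = L k * rho. Proof. by rewrite /level exprSr mulrA. Qed.

Lemma level_le j k : (j <= k)%N -> L j <= L k.
Proof.
by move=> jk; rewrite ler_pM2l// ler_weXn2l// ltW.
Qed.

Lemma level_powR_le j k : (j <= k)%N -> L j `^ e <= L k `^ e.
Proof.
move=> jk; apply: ge0_ler_powR => //; rewrite ?nnegrE ?(ltW (level_gt0 _))//.
exact: level_le.
Qed.

Lemma step_powerS N v : phi N.+1 v =
  phi N v + (L N.+1 `^ e - L N `^ e) * ((L N)%:E < v)%E%:R.
Proof. by rewrite /step_power big_ord_recr /= addrA. Qed.

Lemma step_power_ge N v : l `^ e <= phi N v.
Proof.
rewrite lerDl sumr_ge0// => k _.
by rewrite mulr_ge0// ?ler0n// subr_ge0 level_powR_le.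
Qed.

Lemma step_power_ge0 N v : 0 <= phi N v.
Proof. exact: le_trans (powR_ge0 _ _) (step_power_ge _ _). Qed.

Lemma step_power_le N v : phi N v <= L N `^ e.
Proof.
elim: N => [|N IH]; first by rewrite /step_power big_ord0 addr0 /level expr0 mulr1.
rewrite step_powerS; have := level_powR_le (leqnSn N).
by case: (_ < _)%E => /=; rewrite ?mulr1 ?mulr0; lra.
Qed.

Lemma step_power_above N v : ((L N)%:E < v)%E -> phi N.+1 v = L N.+1 `^ e.
Proof.
elim: N => [|N IH] Nv; rewrite step_powerS Nv mulr1.
  by rewrite /step_power big_ord0 addr0 /level expr0 mulr1; ring.
rewrite IH; first by ring.
by apply: le_lt_trans Nv; rewrite lee_fin level_le.
Qed.

Lemma powR_le_step_power N w v : 0 <= w -> w <= L N -> (w%:E <= v)%E ->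
  w `^ e <= phi N v.
Proof.
move=> w0 + wv; elim: N => [|N IH] wN.
  apply: le_trans (step_power_ge _ _); move: wN; rewrite /level expr0 mulr1 => wN.
  by apply: ge0_ler_powR => //; rewrite ?nnegrE// ltW.
have [wN'|Nw] := leP w (L N).
  rewrite step_powerS (le_trans (IH wN'))// lerDl.
  by rewrite mulr_ge0// ?ler0n// subr_ge0 level_powR_le.
rewrite step_power_above; last by apply: lt_le_trans wv; rewrite lte_fin.
by apply: ge0_ler_powR => //; rewrite nnegrE// ltW ?level_gt0.
Qed.

Let powR_increment k : L k.+1 `^ e - L k `^ e <= L k `^ e * (e * (rho - 1)).
Proof.
rewrite levelS powRM ?(ltW (level_gt0 _)) ?(ltW rho0)//.
have := ler_wpM2l (powR_ge0 (L k) e) (bernoulli_powR rho0 e01).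
by lra.
Qed.

(** The sum grows geometrically, hence is comparable to its last term; rho is
    the price of using levels in place of an integral over la. *)
Let sum_increments N :
  \sum_(k < N.+1) (L k.+1 `^ e - L k `^ e) * L k <= e * rho * (L N `^ e * L N).
Proof.
elim: N => [|N IH].
  rewrite big_ord1; apply: le_trans (ler_wpM2r (ltW (level_gt0 0)) (powR_increment 0)) _.
  have : 0 <= L 0 `^ e * L 0 * e by rewrite !mulr_ge0// ?powR_ge0// ltW ?level_gt0.
  by lra.
have h0 := ler_wpM2r (ltW (level_gt0 N.+1)) (powR_increment N.+1).
rewrite big_ord_recr /=; apply: le_trans (lerD IH h0) _.
have h1 := ler_wpM2r (ltW (level_gt0 N.+1)) (level_powR_le (leqnSn N)).
have h2 := ler_wpM2l e0 h1.
have := levelS N.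
by move: h2; set a := _ `^ e; set b := _ `^ e; set c := L N.+1; set z := L N => h2 c_eq;
  move: h2; rewrite c_eq; lra.
Qed.

Lemma sum_increments_le_step_power N v : (0 <= v)%E ->
  ((\sum_(k < N) (L k.+1 `^ e - L k `^ e) * L k * ((L k)%:E < v)%E%:R)%:E
   <= (e * rho)%:E * ((phi N v)%:E * v))%E.
Proof.
move=> v0; elim: N => [|N IH].
  rewrite big_ord0 !mule_ge0// lee_fin ?step_power_ge0//.
  by rewrite mulr_ge0// ltW.
have [Nv|Nv] := boolP ((L N)%:E < v)%E; last first.
  by rewrite big_ord_recr step_powerS/= (negbTE Nv) !mulr0 !addr0.
rewrite step_power_above//.
apply: (@le_trans _ _ (e * rho * (L N `^ e * L N))%:E).
  rewrite lee_fin; apply: le_trans (sum_increments N); apply: ler_sum => k _.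
  rewrite ler_piMr ?lern1 ?leq_b1// mulr_ge0// ?subr_ge0 ?level_powR_le//.
  by rewrite ltW ?level_gt0.
have -> : ((e * rho * (L N `^ e * L N))%:E
    = (e * rho)%:E * ((L N `^ e)%:E * (L N)%:E))%E by rewrite -!EFinM.
apply: lee_wpmul2l; first by rewrite lee_fin mulr_ge0// ltW.
apply: lee_pmul => //; rewrite ?lee_fin ?powR_ge0 ?(ltW (level_gt0 _))//.
- by rewrite level_powR_le.
- exact: ltW.
Qed.

End fixed_levels.
End Layers.

Lemma measurable_step_power {dd : measure_display} {T : measurableType dd}
    {R : realType} (m : T -> \bar R) (l rho e : R) (N : nat) :
    measurable_fun [set: T] m ->
  measurable_fun [set: T] (fun x => (step_power l rho e N (m x))%:E).
Proof.
move=> mm; apply/measurable_EFinP; apply: measurable_funD => //.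
apply: measurable_sum => k; apply: measurable_funM => //.
rewrite (_ : (fun x => _) = \1_[set x | ((level l rho k)%:E < m x)%E]).
  by apply: measurable_indic; rewrite -[X in measurable X]setTI; exact: emeasurable_fun_o_infty.
apply/funext => x; rewrite indicE; congr (_%:R); congr nat_of_bool.
by apply/idP/idP; rewrite inE.
Qed.

(** Superlevel estimates self-improve: a bound of the g-mass of [m > la] by
    [A * la] times its measure becomes, after summation over the levels, a bound
    of the integral of [m `^ e * g] by that of [m `^ (1 + e)], with the small
    factor [e]. For [g = m] the last integral can be absorbed. *)
Lemma ge0_integral_step_power {dd : measure_display} {T : measurableType dd}
    {R : realType} (mu : {measure set T -> \bar R}) (Q : set T)
    (m g : T -> \bar R) (l rho e A : R) (N : nat) :
    0 < l -> 1 < rho -> 0 <= e <= 1 -> 0 <= A -> measurable Q ->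
    measurable_fun [set: T] m -> (forall x, 0 <= m x)%E ->
    measurable_fun [set: T] g -> (forall x, 0 <= g x)%E ->
    (forall la, (l <= la)%R ->
      \int[mu]_(x in Q `&` [set x | la%:E < m x]) g x
      <= (A * la)%:E * mu (Q `&` [set x | la%:E < m x]))%E ->
  (\int[mu]_(x in Q) ((step_power l rho e N (m x))%:E * g x)
   <= (l `^ e)%:E * \int[mu]_(x in Q) g x
      + (A * (e * rho))%:E
        * \int[mu]_(x in Q) ((step_power l rho e N (m x))%:E * m x))%E.
Proof.
move=> l0 rho1 e01 A0 mQ mm m0 mg g0 H.
pose L := level l rho; pose Om k := [set x | ((L k)%:E < m x)%E].
pose de k := L k.+1 `^ e - L k `^ e.
have de0 k : 0 <= de k by rewrite subr_ge0; exact: level_powR_le.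
have L0 k : 0 < L k by exact: level_gt0.
have term0 k x : 0 <= de k * L k * ((L k)%:E < m x)%E%:R.
  exact: mulr_ge0 (mulr_ge0 (de0 k) (ltW (L0 k))) (ler0n _ _).
have mOm k : measurable (Om k).
  by rewrite -[Om k]setTI; exact: emeasurable_fun_o_infty.
have indE k x : (((L k)%:E < m x)%E%:R)%R = \1_(Om k) x :> R.
  by rewrite indicE; congr (_%:R); congr nat_of_bool; apply/idP/idP; rewrite inE.
have mind k : measurable_fun [set: T] (fun x => (\1_(Om k) x)%:E : \bar R).
  by apply/measurable_EFinP; exact: measurable_indic.
have mphi : measurable_fun [set: T] (fun x => (step_power l rho e N (m x))%:E).
  exact: measurable_step_power.
(* One layer: the hypothesis at the level L k, weighted by a jump of the power. *)
have layer k : ((de k)%:E * \int[mu]_(x in Q) ((\1_(Om k) x)%:E * g x)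
    <= A%:E * \int[mu]_(x in Q) (de k * L k * \1_(Om k) x)%:E)%E.
  have -> : (\int[mu]_(x in Q) ((\1_(Om k) x)%:E * g x)
      = \int[mu]_(x in Q `&` Om k) g x)%E.
    rewrite integral_mkcondr; apply: eq_integral => x _.
    by rewrite epatch_indic muleC.
  under [in leRHS]eq_integral do rewrite EFinM.
  rewrite ge0_integralZl_EFin//; first last.
  - by rewrite mulr_ge0// ltW.
  - exact: measurable_funTS.
  rewrite integral_indic// setIC muleA -EFinM.
  have -> : A * (de k * L k) = de k * (A * L k) by ring.
  rewrite EFinM -muleA; apply: lee_wpmul2l; first by rewrite lee_fin.
  by rewrite setIC; apply: H; rewrite -[l]mulr1 -(expr0 rho) level_le.
have -> : (\int[mu]_(x in Q) ((step_power l rho e N (m x))%:E * g x)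
   = (l `^ e)%:E * \int[mu]_(x in Q) g x
     + \sum_(k < N) (de k)%:E * \int[mu]_(x in Q) ((\1_(Om k) x)%:E * g x))%E.
  have split_phi x : ((step_power l rho e N (m x))%:E * g x =
      (l `^ e)%:E * g x + \sum_(k < N) ((de k)%:E * ((\1_(Om k) x)%:E * g x)))%E.
    rewrite /step_power EFinD ge0_muleDl ?lee_fin ?powR_ge0//; last first.
      by apply: sumr_ge0 => k _; exact: mulr_ge0 (de0 k) (ler0n _ _).
    congr (_ + _)%E; rewrite -sumEFin ge0_sume_distrl; last first.
      by move=> k _; rewrite lee_fin; exact: mulr_ge0 (de0 k) (ler0n _ _).
    by apply: eq_bigr => k _; rewrite indE EFinM muleA.
  under eq_integral do rewrite split_phi.
  have pos k x : (0 <= (de k)%:E * ((\1_(Om k) x)%:E * g x))%E.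
    by rewrite !mule_ge0// lee_fin.
  have mterm k : measurable_fun Q (fun x => (\1_(Om k) x)%:E * g x)%E.
    by apply: emeasurable_funM; apply: measurable_funTS.
  rewrite ge0_integralD//; first last.
  - by apply: emeasurable_sum => k; apply: measurable_funeM.
  - by move=> x _; exact: sume_ge0.
  - by apply: measurable_funeM; exact: measurable_funTS.
  - by move=> x _; rewrite mule_ge0// lee_fin powR_ge0.
  rewrite ge0_integralZl_EFin ?powR_ge0//; last exact: measurable_funTS.
  congr (_ + _)%E; rewrite ge0_integral_sum//; last first.
    by move=> k; apply: measurable_funeM.
  apply: eq_bigr => k _; rewrite ge0_integralZl_EFin// => x _.
  by rewrite mule_ge0// lee_fin.
apply: leeD => //.
apply: (@le_trans _ _ (A%:E * \int[mu]_(x in Q)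
    (\sum_(k < N) de k * L k * ((L k)%:E < m x)%E%:R)%:E)%E).
  under [in leRHS]eq_integral do rewrite -sumEFin.
  rewrite ge0_integral_sum//; first last.
  - by move=> k x _; rewrite lee_fin; exact: term0.
  - move=> k; under eq_fun do rewrite indE; apply/measurable_EFinP.
    by apply: measurable_funM => //; exact: measurable_indic.
  rewrite ge0_sume_distrr; last first.
    move=> k _; apply: integral_ge0 => x _.
    by rewrite lee_fin; exact: term0.
  apply: lee_sum => k _; apply: le_trans (layer k) _.
  by under eq_integral do rewrite -indE.
rewrite EFinM -muleA; apply: lee_wpmul2l; first by rewrite lee_fin.
rewrite -ge0_integralZl_EFin//; first last.
- by rewrite mulr_ge0// ?(ltW (lt_trans _ rho1))//; case/andP: e01.
- by apply: emeasurable_funM; apply: measurable_funTS.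
- by move=> x _; rewrite mule_ge0// lee_fin step_power_ge0.
apply: ge0_le_integral => //.
- by move=> x _; rewrite lee_fin sumr_ge0// => k _; exact: term0.
- apply/measurable_EFinP; apply: measurable_sum => k.
  under eq_fun do rewrite indE.
  by apply: measurable_funM => //; exact: measurable_indic.
- apply: measurable_funeM; apply: emeasurable_funM; exact: measurable_funTS.
- by move=> x _; exact: sum_increments_le_step_power.
Qed.

(** * Balls and doubling *)

Section Homogeneous.
Context {R : realType} {S : ptopologicalType}.
Variables (d : S -> S -> R) (kappa : R) (mu : {measure set (borel S) -> \bar R}).
Hypotheses (Hh : is_homogeneous_type kappa d mu) (Hs : standing_assumptions d mu).
Local Notation D := (doubling_order d mu).

Lemma measurable_qball x s : 0 < s -> measurable (qball d x s : set (borel S)).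
Proof. by move=> s0; apply: sub_sigma_algebra; exact: (Defs.ball_open Hs). Qed.

Lemma kappa_ge1 : 1 <= kappa.
Proof. by case: Hh => [[]]. Qed.

Lemma qdist_sym x y : d x y = d y x.
Proof. by case: Hh => [[]]. Qed.

Lemma qdist_lt x y z u v : d x y < u -> d y z < v -> d x z < kappa * (u + v).
Proof.
move=> xyu yzv; have [[_ _ _ _ tri] _ _] := Hh.
apply: le_lt_trans (tri x z y) _.
by rewrite ltr_pM2l ?ltrD// (lt_le_trans ltr01 kappa_ge1).
Qed.

Lemma qball_center x s : 0 < s -> qball d x s x.
Proof.
have [[_ _ d0 _ _] _ _] := Hh.
by rewrite /qball/= => s0; have [_ ->] := d0 x x.
Qed.

Lemma qball_sub x y s t u : d x y < u -> kappa * (u + s) <= t ->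
  qball d y s `<=` qball d x t.
Proof.
by move=> xy le_t z yz; apply: lt_le_trans le_t; exact: qdist_lt xy yz.
Qed.

Lemma qball_le x s t : s <= t -> qball d x s `<=` qball d x t.
Proof. by move=> st y /lt_le_trans; apply. Qed.

Lemma qball_gt0 x s : 0 < s -> (0 < mu (qball d x s))%E.
Proof. exact: (ball_measure_gt0 Hs). Qed.

Lemma qball_lty x s : 0 < s -> (mu (qball d x s) < +oo)%E.
Proof. exact: (ball_measure_lty Hs). Qed.

Lemma qball_fin x s : 0 < s -> mu (qball d x s) \is a fin_num.
Proof. by move=> s0; rewrite ge0_fin_numE// qball_lty. Qed.

Lemma le_mu_qball x y s t : 0 < s -> 0 < t -> qball d x s `<=` qball d y t ->
  (mu (qball d x s) <= mu (qball d y t))%E.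
Proof. by move=> s0 t0 ?; apply: le_measure; rewrite ?inE//; exact: measurable_qball. Qed.

Lemma doubling_bound_ge1 C : doubling_bound d mu C -> 1 <= C.
Proof.
move=> HC; have := HC point 1 ltr01.
have le12 : (mu (qball d point 1) <= mu (qball d point (2 * 1)))%E.
  by apply: le_mu_qball => //; apply: qball_le; lra.
move=> /(le_trans le12); rewrite -(fineK (qball_fin point ltr01)) -EFinM lee_fin.
rewrite ler_pMl// fine_gt0// qball_lty// andbT; exact: qball_gt0.
Qed.

(** The infimum defining the doubling constant is attained, since each
    instance of the doubling inequality is a closed condition on C. *)
Lemma doubling_const_bound : doubling_bound d mu (doubling_const d mu).
Proof.
have [_ _ [C0 HC0]] := Hh.
move=> x s s0; have s20 : 0 < 2 * s by rewrite mulr_gt0.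
have v0 : 0 < fine (mu (qball d x s)) by rewrite fine_gt0// qball_gt0//= qball_lty.
rewrite -(fineK (qball_fin x s0)) -(fineK (qball_fin x s20)) -EFinM lee_fin.
rewrite -ler_pdivrMr//; apply: lb_le_inf; first by exists C0.
move=> C /(_ x s s0).
by rewrite -(fineK (qball_fin x s0)) -(fineK (qball_fin x s20)) -EFinM lee_fin ler_pdivrMr.
Qed.

Lemma doubling_const_ge1 : 1 <= doubling_const d mu.
Proof. exact: doubling_bound_ge1 doubling_const_bound. Qed.

Lemma doubling_order_ge0 : 0 <= D.
Proof.
rewrite divr_ge0// ln_ge0//; first exact: doubling_const_ge1.
by rewrite ler1n.
Qed.

Lemma powR2_doubling_order : 2 `^ D = doubling_const d mu.
Proof.
have C0 : 0 < doubling_const d mu := lt_le_trans ltr01 doubling_const_ge1.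
apply: ln_inj; rewrite ?posrE ?powR_gt0// ln_powR divfK//.
by rewrite gt_eqF// ln_gt0// ltr1n.
Qed.

(** Iterating the doubling inequality up to the least power of 2 that is at
    least [a], which is less than [2 * a]. *)
Lemma mu_qball_dilate x s a : 0 < s -> 1 <= a ->
  (mu (qball d x (a * s)) <= ((2 * a) `^ D)%:E * mu (qball d x s))%E.
Proof.
move=> s0 a1.
have dbl n : (mu (qball d x (2 ^+ n * s)) <= ((2 ^+ n) `^ D)%:E * mu (qball d x s))%E.
  elim: n => [|n IH]; first by rewrite expr0 mul1r powR1 mul1e.
  rewrite exprS -mulrA; apply: le_trans (doubling_const_bound _ _) _.
    by rewrite mulr_gt0// exprn_gt0.
  rewrite powRM ?exprn_ge0// powR2_doubling_order EFinM -muleA.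
  by rewrite lee_wpmul2l// lee_fin (le_trans ler01 doubling_const_ge1).
have exn : exists n, a <= 2 ^+ n.
  exists (Num.bound a); apply: ltW; apply: lt_le_trans (archi_boundP _) _.
    exact: le_trans a1.
  by rewrite -natrX ler_nat ltnW// ltn_expl.
pose n := ex_minn exn; have : a <= 2 ^+ n /\ 2 ^+ n <= 2 * a.
  rewrite /n; case: ex_minnP => -[|k] ak mink; split=> //.
    by rewrite expr0; lra.
  rewrite exprS ler_pM2l// leNgt; apply/negP => /ltW /mink.
  by rewrite ltnn.
move=> [an na]; have a0 : 0 < a by apply: lt_le_trans a1.
apply: (@le_trans _ _ (mu (qball d x (2 ^+ n * s)))).
  apply: le_mu_qball; rewrite ?mulr_gt0 ?exprn_gt0//.
  by apply: qball_le; rewrite ler_pM2r.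
apply: le_trans (dbl n) _; apply: lee_wpmul2r => //.
by rewrite lee_fin ge0_ler_powR ?nnegrE ?exprn_ge0 ?doubling_order_ge0// mulr_ge0// ltW.
Qed.

Lemma mu_qball_sub x y s t a : 0 < s -> 0 < t -> 1 <= a ->
  qball d x t `<=` qball d y (a * s) ->
  (mu (qball d x t) <= ((2 * a) `^ D)%:E * mu (qball d y s))%E.
Proof.
move=> s0 t0 a1 sub; apply: le_trans (mu_qball_dilate _ s0 a1).
by apply: le_mu_qball => //; rewrite mulr_gt0// (lt_le_trans ltr01).
Qed.

Lemma open_superlevel_measurable (f : S -> \bar R) :
  (forall a : R, open [set x | (a%:E < f x)%E]) ->
  measurable_fun [set: borel S] (f : borel S -> \bar R).
Proof.
move=> fo; apply: (measurability _ (ErealGenOInfty.measurableE R)) => _ [_ [a ->] <-].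
rewrite setTI; apply: sub_sigma_algebra.
rewrite (_ : _ @^-1` _ = [set x | (a%:E < f x)%E]); first exact: fo.
by apply/seteqP; split => x /=; rewrite in_itv/= andbT.
Qed.

Lemma average_le x s (f : S -> \bar R) c : 0 < s ->
  (average mu (qball d x s) f <= c%:E)%E =
  (\int[mu]_(y in qball d x s) f y <= c%:E * mu (qball d x s))%E.
Proof.
move=> s0; rewrite /average -(fineK (qball_fin x s0)).
have v0 : 0 < fine (mu (qball d x s)) by rewrite fine_gt0// qball_gt0//= qball_lty.
by rewrite inver gt_eqF// lee_pdivrMl// muleC.
Qed.

Section Weight.
Variable w : S -> R.
Hypotheses (w0 : forall x, 0 <= w x)
  (mw : measurable_fun [set: borel S] (w : borel S -> R))
  (wloc : forall x s, 0 < s -> (\int[mu]_(y in qball d x s) (w y)%:E < +oo)%E).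
Local Notation theta := (4 * kappa ^+ 2 + kappa).
Local Notation Bl b := (qball d b.1 b.2).

Let k1 : 1 <= kappa := kappa_ge1.
Let k0 : 0 < kappa := lt_le_trans ltr01 k1.

Lemma theta_ge : 5 * kappa <= theta.
Proof. by rewrite expr2; have := ler_wpM2r (ltW k0) k1; lra. Qed.

Let mwE : measurable_fun [set: borel S] (fun x : borel S => (w x)%:E).
Proof. exact/measurable_EFinP. Qed.

Let wE0 x : (0 <= (w x)%:E)%E.
Proof. by rewrite lee_fin. Qed.

Lemma weight_int_le (A B : set (borel S)) : measurable A -> measurable B ->
  A `<=` B -> (\int[mu]_(y in A) (w y)%:E <= \int[mu]_(y in B) (w y)%:E)%E.
Proof.
move=> mA mB AB; apply: ge0_subset_integral => //.
exact: measurable_funTS.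
Qed.

(** * Maximal functions *)

Lemma maximal_fun_ge0 (f : S -> R) y : (0 <= maximal_fun d mu f y)%E.
Proof.
apply: le_ereal_sup_tmp.
exists (average mu (qball d y 1) (fun z => `|(f z)%:E|)%E).
  by exists y, 1; split => //; exact: qball_center.
rewrite mule_ge0 ?inve_ge0//; exact: integral_ge0.
Qed.

Lemma measurable_maximal_fun (f : S -> R) :
  measurable_fun [set: borel S] (maximal_fun d mu f : borel S -> \bar R).
Proof.
apply: open_superlevel_measurable => a.
rewrite (_ : [set x | _] = \bigcup_(b in [set b : S * R | 0 < b.2 /\
    (a%:E < average mu (Bl b) (fun y => `|(f y)%:E|))%E]) Bl b).
  by apply: bigcup_open => b [b0 _]; exact: (Defs.ball_open Hs).
apply/seteqP; split => [x /ereal_sup_gt[_ [z [s [s0 zx ->]]] az]|x [[z s]/= [s0 az] zx]].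
  by exists (z, s).
apply/ereal_sup_gtP; exists (average mu (qball d z s) (fun y => `|(f y)%:E|)%E) => //.
by exists z, s.
Qed.

(** If the ball has no w-mass, the inverse of that mass is infinite and
    finiteness of the constant forces the integral to vanish; otherwise the
    denominator is cleared. *)
Lemma int_maximal_le x s (W : R) : 0 <= W -> (Ainfty_const d mu w <= W%:E)%E -> 0 < s ->
  (\int[mu]_(y in qball d x s)
     maximal_fun d mu (fun z => w z * \1_(qball d x s) z)%R y
   <= W%:E * \int[mu]_(y in qball d x s) (w y)%:E)%E.
Proof.
move=> W0 AW s0.
set I := (\int[mu]_(y in _) maximal_fun _ _ _ _)%E.
have I0 : (0 <= I)%E by apply: integral_ge0 => y _; exact: maximal_fun_ge0.
have : ((wmeasure mu w (qball d x s))^-1 * I <= W%:E)%E.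
  by apply: le_trans AW; apply: ereal_sup_ubound; exists x, s.
rewrite -[X in (_ <= _ * X)%E]/(wmeasure mu w (qball d x s)).
have : (0 <= wmeasure mu w (qball d x s))%E by exact: integral_ge0.
have : (wmeasure mu w (qball d x s) < +oo)%E by exact: wloc.
case: (wmeasure _ _ _) => [v _| |]//; rewrite lee_fin le_eqVlt => /predU1P[<-|v0].
  rewrite inve0 mule0; move: I0; rewrite le_eqVlt => /predU1P[<-//|Ipos].
  by rewrite gt0_mulye// leye_eq.
by rewrite inver gt_eqF// lee_pdivrMl// muleC.
Qed.

Section LocalBall.
Variables (x0 : S) (r : R).
Hypothesis r0 : 0 < r.
Local Notation Q := (qball d x0 (2 * kappa * r)).

Definition local_balls : set (S * R) :=
  [set b | d x0 b.1 < r /\ 0 < b.2 <= r].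

(** The value 0 is included so that the function vanishes, rather than being
    [-oo], off the union of the local balls. *)
Definition local_maximal (y : S) : \bar R :=
  ereal_sup (0%E |` [set average mu (Bl b) (EFin \o w) |
                     b in [set b : S * R | local_balls b /\ Bl b y]]).

Definition heavy (la : R) : set (S * R) :=
  [set b | local_balls b /\ (la%:E < average mu (Bl b) (EFin \o w))%E].

(** Near-maximality of the radius among the heavy balls through a single point of
    the ball already prevents its local dilates by more than 2 from being heavy. *)
Definition stopped (la : R) : set (S * R) :=
  [set b | heavy la b /\
     exists2 x, Bl b x & forall b', heavy la b' -> Bl b' x -> b'.2 <= 2 * b.2].

Let R0 : 0 < 2 * kappa * r. Proof. by rewrite !mulr_gt0. Qed.

Lemma local_ball_sub b : local_balls b -> Bl b `<=` Q.
Proof.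
move=> [xb /andP[b0 br]]; apply: (qball_sub xb).
have -> : 2 * kappa * r = kappa * (r + r) by ring.
by rewrite ler_pM2l// lerD2l.
Qed.

Lemma sub_local_ball b : local_balls b ->
  Q `<=` qball d b.1 ((2 * kappa ^+ 2 + kappa) * r).
Proof.
move=> [xb _]; apply: (@qball_sub b.1 x0 _ _ r); first by rewrite qdist_sym.
have -> // : kappa * (r + 2 * kappa * r) = (2 * kappa ^+ 2 + kappa) * r by ring.
Qed.

Lemma local_maximal_gt la y : 0 <= la ->
  (la%:E < local_maximal y)%E <-> exists2 b, heavy la b & Bl b y.
Proof.
move=> la0; split.
  move=> /ereal_sup_gt[_ [->|[b [lb yb] <-]] lay].
    by move: lay; rewrite lte_fin ltNge la0.
  by exists b.
move=> [b [lb lab] yb]; apply/ereal_sup_gtP.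
by exists (average mu (Bl b) (EFin \o w)) => //; right; exists b.
Qed.

Lemma local_maximal_ge0 y : (0 <= local_maximal y)%E.
Proof. by apply: ereal_sup_ubound; left. Qed.

Lemma measurable_local_maximal :
  measurable_fun [set: borel S] (local_maximal : borel S -> \bar R).
Proof.
apply: open_superlevel_measurable => a; have [a0|a0] := leP 0 a.
  rewrite (_ : [set x | _] = \bigcup_(b in heavy a) Bl b).
    by apply: bigcup_open => b [[_ /andP[b0 _]] _]; exact: (Defs.ball_open Hs).
  apply/seteqP; split => [x /(local_maximal_gt _ a0)[b hb xb]|x [b hb xb]].
    by exists b.
  by apply/(local_maximal_gt _ a0); exists b.
rewrite (_ : [set x | _] = setT); first exact: openT.
apply/seteqP; split => // x _ /=; apply: lt_le_trans (local_maximal_ge0 x).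
by rewrite lte_fin.
Qed.

Lemma local_maximal_le_maximal y :
  (local_maximal y <= maximal_fun d mu (fun z => w z * \1_Q z)%R y)%E.
Proof.
apply: ge_ereal_sup => _ [->|[b [lb yb] <-]]; first exact: maximal_fun_ge0.
have [_ /andP[b0 _]] := lb.
apply: ereal_sup_ubound; exists b.1, b.2; split => //.
congr (_ * _)%E; apply: eq_integral => z; rewrite inE => bz /=.
have Qz : Q z by exact: local_ball_sub bz.
by rewrite indicE mem_set// mulr1 ger0_norm.
Qed.

(** * Stopped balls *)

Section Level.
Variable la : R.
Hypotheses (la0 : 0 < la)
  (Hla : (((2 * kappa ^+ 2 + kappa) `^ D)%:E * \int[mu]_(y in Q) (w y)%:E
          <= la%:E * mu Q)%E).

Let kk0 : 0 < 2 * kappa ^+ 2 + kappa.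
Proof. by rewrite addr_gt0// mulr_gt0// exprn_gt0. Qed.

Let kk1 : 1 <= 2 * kappa ^+ 2 + kappa.
Proof. by apply: le_trans k1 _; rewrite lerDr mulr_ge0// exprn_ge0// ltW. Qed.

(** When the dilate of a local ball outgrows the local scale it is replaced by
    Q, over which the average is small by the choice of the initial level. *)
Lemma weight_Q_le b a : local_balls b -> r <= a * b.2 ->
  (\int[mu]_(y in Q) (w y)%:E <= (la * (2 * a) `^ D)%:E * mu (Bl b))%E.
Proof.
move=> lb rab; have [_ /andP[b0 br]] := lb.
have a1 : 1 <= a by rewrite -(ler_pM2r b0) mul1r (le_trans br).
have a0 : 0 < a by apply: lt_le_trans a1.
have L0 : 0 < (2 * kappa ^+ 2 + kappa) `^ D by exact: powR_gt0.
rewrite -(@lee_pmul2l _ ((2 * kappa ^+ 2 + kappa) `^ D)%:E)//.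
apply: (le_trans Hla).
have QB : Q `<=` qball d b.1 ((2 * kappa ^+ 2 + kappa) * a * b.2).
  apply: subset_trans (sub_local_ball lb) _; apply: qball_le.
  by rewrite -mulrA ler_pM2l.
have a1' : 1 <= (2 * kappa ^+ 2 + kappa) * a by exact: mulr_ege1.
have := mu_qball_sub b0 R0 a1' QB.
have -> : 2 * ((2 * kappa ^+ 2 + kappa) * a) = (2 * kappa ^+ 2 + kappa) * (2 * a) by ring.
rewrite powRM ?(ltW kk0) ?mulr_ge0 ?(ltW a0)// => le_mu.
have la0' : (0 <= la%:E)%E by rewrite lee_fin ltW.
apply: le_trans (lee_wpmul2l la0' le_mu) _.
by rewrite !muleA -!EFinM mulrCA.
Qed.

Lemma light_weight_le b : local_balls b -> ~ heavy la b ->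
  (\int[mu]_(y in Bl b) (w y)%:E <= la%:E * mu (Bl b))%E.
Proof.
move=> lb nh; have [_ /andP[b0 br]] := lb.
by rewrite -average_le// leNgt; apply/negP => lab; apply: nh; split.
Qed.

(** Doubling compares the dilate with B; when it is no longer local, Q takes its
    place at the same cost. *)
Lemma light_dilate_le b a (A : set S) : local_balls b -> 1 <= a ->
    (local_balls (b.1, a * b.2) -> ~ heavy la (b.1, a * b.2)) ->
    measurable (A : set (borel S)) -> A `<=` qball d b.1 (a * b.2) -> A `<=` Q ->
  (\int[mu]_(y in A) (w y)%:E <= (la * (2 * a) `^ D)%:E * mu (Bl b))%E.
Proof.
move=> lb a1 light mA AB AQ; have [xb /andP[b0 br]] := lb.
have a0 : 0 < a by apply: lt_le_trans a1.
have mQ : measurable (Q : set (borel S)) by exact: measurable_qball.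
have [abr|rab] := leP (a * b.2) r; last first.
  by apply: le_trans (weight_Q_le lb (ltW rab)); exact: weight_int_le.
have lb' : local_balls (b.1, a * b.2) by split => //=; rewrite mulr_gt0.
have mab : measurable (qball d b.1 (a * b.2) : set (borel S)).
  by apply: measurable_qball; rewrite mulr_gt0.
apply: (le_trans (weight_int_le mA mab AB)).
apply: le_trans (light_weight_le lb' (light lb')) _ => /=.
rewrite EFinM -muleA; apply: lee_wpmul2l; first by rewrite lee_fin ltW.
exact: mu_qball_dilate.
Qed.

Lemma stopped_weight_le b a : stopped la b -> 2 < a ->
  (\int[mu]_(y in qball d b.1 (a * b.2) `&` Q) (w y)%:E
   <= (la * (2 * a) `^ D)%:E * mu (Bl b))%E.
Proof.
move=> [[lb hb] [x bx xmax]] a2; have [xb /andP[b0 br]] := lb.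
have a0 : 0 < a by apply: lt_trans a2.
apply: light_dilate_le => //.
- by apply: ltW; apply: lt_trans a2; rewrite ltr1n.
- move=> _ /xmax/= xle; have : a * b.2 <= 2 * b.2.
    apply: xle; apply: qball_le bx; rewrite ler_peMl ?(ltW b0)//.
    by apply: ltW; apply: lt_trans a2; rewrite ltr1n.
  by rewrite ler_pM2r// leNgt a2.
- by apply: measurableI; apply: measurable_qball; rewrite // mulr_gt0.
Qed.

Let theta_gt2 : 2 < theta.
Proof. by have := theta_ge; move: k1; lra. Qed.

Let theta_gt0 : 0 < theta.
Proof. exact: lt_trans theta_gt2. Qed.

(** The dilate by [2 * kappa] of a large local ball that reaches [theta B]
    contains the stopping point of B, so it is not heavy; doubling returns from
    this dilate to the ball. *)
Lemma far_average_le b b' y : stopped la b -> local_balls b' ->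
  Bl b' y -> qball d b.1 (theta * b.2) y -> 2 * kappa * theta * b.2 < b'.2 ->
  (average mu (Bl b') (EFin \o w) <= (la * (4 * kappa) `^ D)%:E)%E.
Proof.
move=> [[lb hb] [x bx xmax]] lb' b'y by_ far; have [xb /andP[b0 br]] := lb.
have [_ /andP[b'0 b'r]] := lb'.
have b'x : qball d b'.1 (2 * kappa * b'.2) x.
  have yx : d y x < b'.2.
    rewrite /qball/= qdist_sym in by_; apply: lt_le_trans (qdist_lt by_ bx) _.
    apply: le_trans (ltW far).
    have -> : 2 * kappa * theta * b.2 = kappa * (theta * b.2 + theta * b.2) by ring.
    rewrite ler_pM2l// lerD2l ler_peMl ?(ltW b0)//.
    by move: theta_gt2; lra.
  have -> : 2 * kappa * b'.2 = kappa * (b'.2 + b'.2) by ring.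
  exact: qdist_lt b'y yx.
have two_k1 : 1 <= 2 * kappa by move: k1; lra.
rewrite average_le//.
have -> : 4 * kappa = 2 * (2 * kappa) by ring.
apply: light_dilate_le => //.
- move=> _ /xmax/=/(_ b'x); apply/negP; rewrite -ltNge.
  rewrite -mulrA ltr_pM2l//; apply: (@lt_le_trans _ _ b'.2); last first.
    exact: ler_peMl (ltW b'0) k1.
  apply: le_lt_trans far; apply: ler_peMl (ltW b0) _.
  by apply: mulr_ege1 => //; move: theta_gt2; lra.
- exact: measurable_qball.
- apply: qball_le; exact: ler_peMl (ltW b'0) two_k1.
- exact: local_ball_sub.
Qed.

(** The radius comes from [kappa * (theta + 4 * kappa ^+ 2 * theta)], where
    [4 * kappa ^+ 2 <= theta - 1]. *)
Lemma near_ball_sub b b' y : local_balls b -> local_balls b' ->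
  Bl b' y -> qball d b.1 (theta * b.2) y -> b'.2 <= 2 * kappa * theta * b.2 ->
  Bl b' `<=` qball d b.1 (kappa * theta ^+ 2 * b.2).
Proof.
move=> [_ /andP[b0 _]] [_ /andP[b'0 _]] b'y by_ near_ z b'z.
have yz : d y z < kappa * (b'.2 + b'.2).
  by rewrite /qball/= qdist_sym in b'y; exact: qdist_lt b'y b'z.
apply: lt_le_trans (qdist_lt by_ yz) _.
have -> : kappa * theta ^+ 2 * b.2 = kappa * (theta * b.2 + theta * b.2 * (theta - 1)) by ring.
rewrite ler_pM2l// lerD2l.
apply: (@le_trans _ _ (4 * kappa ^+ 2 * (theta * b.2))).
  have -> : 4 * kappa ^+ 2 * (theta * b.2)
    = kappa * (2 * kappa * theta * b.2 + 2 * kappa * theta * b.2) by ring.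
  by rewrite ler_pM2l// lerD.
rewrite mulrC ler_pM2l ?mulr_gt0//.
by move: k1; lra.
Qed.

(** Localization: near a stopped ball, the local maximal function sees the weight
    far away only through light averages. *)
Lemma local_maximal_near_stopped b y : stopped la b ->
  qball d b.1 (theta * b.2) y ->
  (local_maximal y <=
     maximal_fun d mu
       (fun z => w z * \1_(qball d b.1 (kappa * theta ^+ 2 * b.2)) z)%R y
     + (la * (4 * kappa) `^ D)%:E)%E.
Proof.
move=> sb by_; have [[lb _] _] := sb.
have c0 : 0 <= la * (4 * kappa) `^ D by rewrite mulr_ge0 ?powR_ge0// ltW.
apply: ge_ereal_sup => _ [->|[b' [lb' b'y] <-]].
  by rewrite adde_ge0 ?maximal_fun_ge0// lee_fin.
have [near_|far] := leP b'.2 (2 * kappa * theta * b.2); last first.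
  apply: le_trans (far_average_le sb lb' b'y by_ far) _.
  by rewrite leeDr// maximal_fun_ge0.
rewrite -[leLHS]adde0; apply: leeD; last by rewrite lee_fin.
have [_ /andP[b'0 _]] := lb'.
apply: ereal_sup_ubound; exists b'.1, b'.2; split => //.
congr (_ * _)%E; apply: eq_integral => z; rewrite inE => b'z /=.
have bz := near_ball_sub lb lb' b'y by_ near_ b'z.
by rewrite indicE mem_set// mulr1 ger0_norm.
Qed.

(** A common bound for the doubling constants below; [tau] is [6 * P]. *)
Let P := (32 * kappa ^+ 2 * theta ^+ 2) `^ D.

Lemma powR_order_le a : 0 <= a -> a <= 32 * kappa ^+ 2 * theta ^+ 2 -> a `^ D <= P.
Proof.
move=> a0 le_a; apply: ge0_ler_powR => //; rewrite ?nnegrE//.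
  exact: doubling_order_ge0.
exact: le_trans le_a.
Qed.

Let theta_ge1 : 1 <= theta.
Proof. by move: theta_gt2; lra. Qed.

Let kt1 : 1 <= kappa * theta.
Proof. exact: mulr_ege1. Qed.

Lemma near_constant_le : (2 * (kappa * theta ^+ 2)) `^ D <= P.
Proof.
have t0 : 0 <= kappa * theta ^+ 2 by rewrite mulr_ge0 ?exprn_ge0 ?ltW.
apply: powR_order_le; first by rewrite mulr_ge0.
have := ler_wpM2r t0 k1.
have -> : 32 * kappa ^+ 2 * theta ^+ 2 = 32 * (kappa * (kappa * theta ^+ 2)) by ring.
by lra.
Qed.

Lemma dilate_constant_le : (2 * theta) `^ D <= P.
Proof.
apply: powR_order_le; first by rewrite mulr_ge0// ltW.
have h1 := ler_wpM2r (ltW theta_gt0) theta_ge1.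
have t0 : 0 <= theta ^+ 2 by rewrite exprn_ge0// ltW.
have kk : 1 <= kappa ^+ 2 by rewrite exprn_ege1.
have := ler_wpM2r t0 kk; rewrite [theta ^+ 2]expr2 -[32 * _ * _]mulrA; move: h1.
by have := theta_gt0; lra.
Qed.

Lemma far_constant_le : (4 * kappa) `^ D * (2 * theta) `^ D <= P.
Proof.
rewrite -powRM ?mulr_ge0 ?(ltW k0) ?(ltW theta_gt0)//.
apply: powR_order_le; first by rewrite !mulr_ge0 ?(ltW k0) ?(ltW theta_gt0).
have -> : 4 * kappa * (2 * theta) = 8 * (kappa * theta * 1) by ring.
have -> : 32 * kappa ^+ 2 * theta ^+ 2 = 32 * (kappa * theta * (kappa * theta)) by ring.
have kt0 : 0 <= kappa * theta by apply: le_trans kt1.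
by have := ler_wpM2l kt0 kt1; lra.
Qed.

Lemma stopped_int_weight_le b : stopped la b ->
  (\int[mu]_(y in qball d b.1 (theta * b.2) `&` Q) (w y)%:E
   <= (P * la)%:E * mu (Bl b))%E.
Proof.
move=> sb; apply: le_trans (stopped_weight_le sb theta_gt2) _.
apply: lee_wpmul2r => //; rewrite lee_fin mulrC ler_pM2r//.
exact: dilate_constant_le.
Qed.

(** The hypothesis on w enters here: the integral of the localized maximal
    function over the dilate of B is at most W times the w-mass of the dilate,
    which stopping bounds. The far part contributes one more P, and W >= 1. *)
Lemma stopped_int_maximal_le b W : 1 <= W -> (Ainfty_const d mu w <= W%:E)%E ->
    stopped la b ->
  (\int[mu]_(y in qball d b.1 (theta * b.2) `&` Q) local_maximal y
   <= (2 * P * W * la)%:E * mu (Bl b))%E.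
Proof.
move=> W1 AW sb; have [[lb hb] [x bx xmax]] := sb; have [xb /andP[b0 br]] := lb.
have W0 : 0 <= W by apply: le_trans W1.
have P0 : 0 <= P by exact: powR_ge0.
pose t := kappa * theta ^+ 2.
have t_gt : theta < t.
  have -> : t = theta * (kappa * theta) by rewrite /t; ring.
  rewrite -[ltLHS]mulr1 ltr_pM2l//.
  by apply: lt_le_trans (ler_peMl (ltW theta_gt0) k1); move: theta_gt2; lra.
have t0 : 0 < t by apply: lt_trans t_gt.
have thb0 : 0 < theta * b.2 by rewrite mulr_gt0.
have tb0 : 0 < t * b.2 by rewrite mulr_gt0.
have mM : measurable_fun [set: borel S] (local_maximal : borel S -> \bar R).
  exact: measurable_local_maximal.
have mQ : measurable (Q : set (borel S)) by exact: measurable_qball.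
have mth : measurable (qball d b.1 (theta * b.2) : set (borel S)).
  exact: measurable_qball.
have mt : measurable (qball d b.1 (t * b.2) : set (borel S)).
  exact: measurable_qball.
have [tbr|rtb] := leP (t * b.2) r; last first.
  (* The dilate need not lie in Q: apply the hypothesis on w to Q itself. *)
  apply: (@le_trans _ _ (\int[mu]_(y in Q) local_maximal y)%E).
    apply: ge0_subset_integral => //; first exact: measurableI.
    - exact: measurable_funTS.
    - by move=> y _; exact: local_maximal_ge0.
  apply: (@le_trans _ _ (\int[mu]_(y in Q)
      maximal_fun d mu (fun z => w z * \1_Q z)%R y)%E).
    apply: ge0_le_integral => //.
    - by move=> y _; exact: local_maximal_ge0.
    - exact: measurable_funTS.
    - by apply: measurable_funTS; exact: measurable_maximal_fun.
    - by move=> y _; exact: local_maximal_le_maximal.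
  apply: le_trans (int_maximal_le _ W0 AW R0) _.
  have W0' : (0 <= W%:E)%E by rewrite lee_fin.
  have W0E := lee_wpmul2l W0' (weight_Q_le lb (ltW rtb)).
  apply: (le_trans W0E).
  rewrite muleA -EFinM; apply: lee_wpmul2r => //; rewrite lee_fin.
  have := ler_wpM2l (mulr_ge0 W0 (ltW la0)) near_constant_le.
  have : 0 <= W * la * P by rewrite !mulr_ge0// ltW.
  by rewrite -/t; lra.
pose c := la * (4 * kappa) `^ D.
have c0 : 0 <= c by rewrite mulr_ge0 ?powR_ge0// ltW.
pose M' := maximal_fun d mu (fun z => w z * \1_(qball d b.1 (t * b.2)) z)%R.
have mM' : measurable_fun [set: borel S] (M' : borel S -> \bar R).
  exact: measurable_maximal_fun.
have M'0 y : (0 <= M' y)%E by exact: maximal_fun_ge0.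
apply: (@le_trans _ _ (\int[mu]_(y in qball d b.1 (theta * b.2)) local_maximal y)%E).
  apply: ge0_subset_integral => //; first exact: measurableI.
  - exact: measurable_funTS.
  - by move=> y _; exact: local_maximal_ge0.
apply: (@le_trans _ _ (\int[mu]_(y in qball d b.1 (theta * b.2)) (M' y + c%:E))%E).
  apply: ge0_le_integral => //.
  - by move=> y _; exact: local_maximal_ge0.
  - exact: measurable_funTS.
  - by apply: emeasurable_funD => //; exact: measurable_funTS.
  - by move=> y; exact: local_maximal_near_stopped.
rewrite ge0_integralD//; last exact: measurable_funTS.
rewrite integral_cst//.
have le1 : (\int[mu]_(y in qball d b.1 (theta * b.2)) M' y
    <= (W * (la * (2 * t) `^ D))%:E * mu (Bl b))%E.
  apply: (@le_trans _ _ (\int[mu]_(y in qball d b.1 (t * b.2)) M' y)%E).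
    apply: ge0_subset_integral => //; first exact: measurable_funTS.
    by apply: qball_le; rewrite ler_pM2r// ltW.
  apply: le_trans (int_maximal_le _ W0 AW tb0) _.
  rewrite EFinM -muleA; apply: lee_wpmul2l; first by rewrite lee_fin.
  have := stopped_weight_le sb (lt_trans theta_gt2 t_gt).
  rewrite setIidl//; apply: (@local_ball_sub (b.1, t * b.2)).
  by split => //=; rewrite tb0.
have le2 : (c%:E * mu (qball d b.1 (theta * b.2))
    <= (c * (2 * theta) `^ D)%:E * mu (Bl b))%E.
  rewrite (EFinM c) -muleA; apply: lee_wpmul2l; first by rewrite lee_fin.
  exact: mu_qball_dilate.
apply: le_trans (leeD le1 le2) _.
rewrite -ge0_muleDl ?lee_fin ?mulr_ge0 ?powR_ge0 ?(ltW la0)//.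
apply: lee_wpmul2r => //; rewrite -EFinD lee_fin.
have h1 := ler_wpM2l (mulr_ge0 W0 (ltW la0)) near_constant_le.
have h2 := ler_wpM2l (ltW la0) far_constant_le.
have h3 := ler_wpM2r (mulr_ge0 (ltW la0) P0) W1.
by move: h1 h2 h3; rewrite /c -/t; lra.
Qed.

Lemma stopped_at y : (la%:E < local_maximal y)%E -> exists2 b, stopped la b & Bl b y.
Proof.
move=> /(local_maximal_gt _ (ltW la0))[b hb yb].
pose Z := [set b.2 | b in [set b : S * R | heavy la b /\ Bl b y]].
have Zsup : has_sup Z.
  split; first by exists b.2, b.
  by exists r => _ [b' [[[_ /andP[_ ?]] _] _] <-].
have bZ b' : heavy la b' -> Bl b' y -> b'.2 <= sup Z.
  by move=> hb' yb'; apply: sup_upper_bound => //; exists b'.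
have supZ0 : 0 < sup Z.
  by apply: lt_le_trans (bZ b hb yb); case: hb => [[_ /andP[]]].
have halfZ : 0 < sup Z / 2 by rewrite divr_gt0.
have [_ [b1 [hb1 yb1] <-] lt_b1] := sup_adherent halfZ Zsup.
exists b1 => //; split => //; exists y => // b' hb' yb'.
by have := bZ _ hb' yb'; move: lt_b1; lra.
Qed.

(** This inclusion dictates the value of theta. *)
Lemma qball_near b b' : qball d b.1 b.2 `&` qball d b'.1 b'.2 !=set0 ->
  0 < b.2 -> b.2 <= 2 * b'.2 -> Bl b `<=` qball d b'.1 (theta * b'.2).
Proof.
move=> [z [bz b'z]] b0 le_b y by_.
have zy : d z y < kappa * (b.2 + b.2).
  by rewrite /qball/= qdist_sym in bz; exact: qdist_lt bz by_.
apply: lt_le_trans (qdist_lt b'z zy) _.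
have -> : theta * b'.2 = kappa * (b'.2 + kappa * (2 * b'.2 + 2 * b'.2)) by ring.
by rewrite ler_pM2l// lerD2l ler_pM2l// lerD.
Qed.

(** A superlevel set is covered by the enlargements of disjoint stopped balls,
    which lie inside it: bounds on stopped balls pass to the superlevel set. *)
Lemma int_superlevel_le (g : S -> \bar R) c : 0 <= c ->
    measurable_fun [set: borel S] (g : borel S -> \bar R) ->
    (forall y, 0 <= g y)%E ->
    (forall b, stopped la b ->
      \int[mu]_(y in qball d b.1 (theta * b.2) `&` Q) g y <= c%:E * mu (Bl b))%E ->
  (\int[mu]_(y in Q `&` [set y | la%:E < local_maximal y]) g y
   <= c%:E * mu (Q `&` [set y | la%:E < local_maximal y]))%E.
Proof.
move=> c0 mg g0 H.
have sP b : stopped la b -> local_balls b /\ 0 < b.2 <= r.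
  by move=> [[lb _] _]; split => //; case: lb.
have [|b /sP[_ /andP[]]//|b /sP[_ /andP[]]//|G [GF tG cov]] :=
    @vitali_selection S (S * R)%type R (stopped la) (fun b => Bl b) snd r.
  by move=> b /sP[_ /andP[b0 _]]; exists b.1; exact: qball_center.
have mQ : measurable (Q : set (borel S)) by exact: measurable_qball.
pose Om := Q `&` [set y | (la%:E < local_maximal y)%E].
have mOm : measurable (Om : set (borel S)).
  by apply: emeasurable_fun_o_infty => //; apply: measurable_funTS; exact: measurable_local_maximal.
have Bpos b : G b -> 0 < b.2 by move=> /GF/sP[_ /andP[]].
have mB b : G b -> measurable (Bl b : set (borel S)).
  by move=> /Bpos; exact: measurable_qball.
apply: (@ge0_integral_le_cover _ (borel S) R mu (S * R)%type G (fun b => Bl b)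
  (fun b => qball d b.1 (theta * b.2)) Om Om g c) => //.
- move=> b Gb y yb; have /GF[hb _] := Gb; have [lb _] := hb; split.
    exact: local_ball_sub yb.
  by apply/(local_maximal_gt _ (ltW la0)); exists b.
- apply: le_lt_trans (qball_lty x0 R0).
  by apply: le_measure; rewrite ?inE//; exact: subIsetl.
- by move=> b /Bpos; exact: qball_gt0.
- by move=> b /Bpos b0; apply: measurable_qball; rewrite mulr_gt0.
- move=> y [Qy /stopped_at[b sb yb]]; have [b' Gb' [bb' le_b]] := cov b sb.
  exists b' => //; apply: qball_near yb => //.
  by have [_ /andP[]] := sP _ sb.
- move=> b Gb; apply: le_trans (H b (GF _ Gb)).
  have mth : measurable (qball d b.1 (theta * b.2) : set (borel S)).
    by apply: measurable_qball; rewrite mulr_gt0// Bpos.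
  apply: ge0_subset_integral => //.
  + exact: measurableI.
  + exact: measurableI.
  + exact: measurable_funTS.
  + by apply: setIS; exact: subIsetl.
Qed.

End Level.

Local Notation M := local_maximal.
Local Notation V := (\int[mu]_(y in Q) (w y)%:E)%E.

(** * Integration over the superlevel sets *)

(** A bound for all small centered averages passes to the limit. *)
Lemma ae_le_of_averages (f : S -> R) (A : set S) (F : S -> \bar R) :
    (forall x, 0 <= f x) -> measurable_fun [set: borel S] (f : borel S -> R) ->
    (forall x s, 0 < s -> (\int[mu]_(y in qball d x s) (f y)%:E < +oo)%E) ->
    (forall y s, A y -> 0 < s <= r ->
      (average mu (qball d y s) (EFin \o f) <= F y)%E) ->
  {ae mu, forall y, A y -> ((f y)%:E <= F y)%E}.
Proof.
move=> f0 mf floc le_av.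
have fint x s : 0 < s -> mu.-integrable (qball d x s) (EFin \o f).
  move=> s0; apply/integrableP; split.
    by apply/measurable_EFinP; exact: measurable_funTS.
  under eq_integral do rewrite gee0_abs ?lee_fin//.
  exact: floc.
apply: (ae_imply (T := borel S)) (Defs.differentiation Hs fint) => y cvgy Ay.
apply: (cvge_to_le cvgy); near=> s; apply: le_av => //.
apply/andP; split; near: s; [exact: nbhs_right_gt|exact: nbhs_right_le].
Unshelve. all: by end_near. Qed.

Lemma ae_le_local_maximal :
  {ae mu, forall y, qball d x0 r y -> ((w y)%:E <= M y)%E}.
Proof.
apply: ae_le_of_averages => // y s xy sr; have /andP[s0 _] := sr.
by apply: ereal_sup_ubound; right; exists (y, s) => //; split => //; exact: qball_center.
Qed.

Lemma weight_le_int_maximal :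
  (V <= \int[mu]_(y in Q) maximal_fun d mu (fun z => w z * \1_Q z)%R y)%E.
Proof.
have mQ : measurable (Q : set (borel S)) by exact: measurable_qball.
have mf : measurable_fun [set: borel S] ((fun z => w z * \1_Q z) : borel S -> R).
  by apply: measurable_funM => //; exact: measurable_indic.
have f0 z : 0 <= w z * \1_Q z by rewrite mulr_ge0.
apply: ae_ge0_le_integral => //.
- exact: measurable_funTS.
- by move=> y _; exact: maximal_fun_ge0.
- by apply: measurable_funTS; exact: measurable_maximal_fun.
suff : {ae mu, forall y, setT y ->
    ((w y * \1_Q y)%:E <= maximal_fun d mu (fun z => w z * \1_Q z)%R y)%E}.
  by apply: (ae_imply (T := borel S)) => y /(_ I) + Qy; rewrite indicE mem_set// mulr1.
apply: ae_le_of_averages => //.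
- move=> x s s0; apply: le_lt_trans (wloc x s0); apply: ge0_le_integral => //.
  + exact: measurable_qball.
  + by move=> y _; rewrite lee_fin.
  + by apply: measurable_funTS; exact/measurable_EFinP.
  + exact: measurable_funTS.
  + by move=> y _; rewrite lee_fin ler_piMr// indicE lern1 leq_b1.
- move=> y s _ /andP[s0 _]; apply: ereal_sup_ubound; exists y, s; split => //.
    exact: qball_center.
  by congr (_ * _)%E; apply: eq_integral => z _ /=; rewrite ger0_norm.
Qed.

(** The maximal function of the weight on Q dominates it almost everywhere. *)
Lemma Ainfty_const_ge1 : (0 < V)%E -> (1 <= Ainfty_const d mu w)%E.
Proof.
move=> V0; apply: (@le_trans _ _ ((wmeasure mu w Q)^-1 *
    \int[mu]_(y in Q) maximal_fun d mu (fun z => w z * \1_Q z)%R y)%E); last first.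
  by apply: ereal_sup_ubound; exists x0, (2 * kappa * r).
have := weight_le_int_maximal; have := wloc x0 R0; move: V0; rewrite /wmeasure.
case: V => [v| |]//; rewrite lte_fin => v0 _ le_v.
by rewrite inver gt_eqF// lee_pdivlMl// mule1.
Qed.

Let P := (32 * kappa ^+ 2 * theta ^+ 2) `^ D.

Let P_ge1 : 1 <= P.
Proof.
apply: (@le_trans _ _ (1 `^ D)); first by rewrite powR1.
apply: ge0_ler_powR; rewrite ?nnegrE//.
- exact: doubling_order_ge0.
- exact: mulr_ge0 (mulr_ge0 (ler0n _ 32) (sqr_ge0 _)) (sqr_ge0 _).
- have h1 : 1 <= kappa ^+ 2 by rewrite exprn_ege1.
  have h2 : 1 <= theta ^+ 2.
    by rewrite exprn_ege1//; have := theta_ge; move: k1; lra.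
  by have := mulr_ege1 h1 h2; rewrite -mulrA; lra.
Qed.

Section Estimate.
Variable W : R.
Hypotheses (W1 : 1 <= W) (AW : (Ainfty_const d mu w <= W%:E)%E) (V0 : (0 < V)%E).

(* Every la >= l0 satisfies the condition on levels under which stopped balls
   were studied; e is the increment of the exponent, since 6 P = tau. *)
Let a := fine V / fine (mu Q).
Let L0 := (2 * kappa ^+ 2 + kappa) `^ D.
Let l0 := L0 * a.
Let e := (6 * P * W)^-1.
Let phi N y := step_power l0 (3 / 2) e N (M y).

Let W0 : 0 < W. Proof. exact: lt_le_trans W1. Qed.
Let P0 : 0 < P. Proof. exact: lt_le_trans P_ge1. Qed.
Let Vfin : V \is a fin_num.
Proof. by rewrite ge0_fin_numE ?wloc//; exact: ltW. Qed.
Let Qfin : mu Q \is a fin_num. Proof. exact: qball_fin. Qed.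
Let a0 : 0 < a.
Proof.
rewrite divr_gt0// fine_gt0//; first by rewrite V0 wloc.
by rewrite qball_gt0// qball_lty.
Qed.
Let L0_gt0 : 0 < L0.
Proof. by rewrite powR_gt0// addr_gt0// mulr_gt0// exprn_gt0. Qed.
Let l0_gt0 : 0 < l0. Proof. exact: mulr_gt0. Qed.

Let e0 : 0 < e. Proof. by rewrite invr_gt0 !mulr_gt0. Qed.

Let e_eq : e * (P * W) = 1 / 6.
Proof. by rewrite /e; field; rewrite !gt_eqF. Qed.

Let e1 : 0 <= e <= 1.
Proof.
rewrite (ltW e0)/=.
have h : 1 <= P * W by exact: mulr_ege1.
have := ler_wpM2l (ltW e0) h; rewrite e_eq; lra.
Qed.

Let rho1 : 1 < 3 / 2 :> R. Proof. lra. Qed.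

Let level_hyp la : l0 <= la -> (L0%:E * V <= la%:E * mu Q)%E.
Proof.
rewrite -(fineK Vfin) -(fineK Qfin) -!EFinM lee_fin /l0 /a mulrA ler_pdivrMr//.
by rewrite fine_gt0// qball_gt0// qball_lty.
Qed.

Let mQ : measurable (Q : set (borel S)).
Proof. exact: measurable_qball. Qed.

Let mM : measurable_fun [set: borel S] (M : borel S -> \bar R).
Proof. exact: measurable_local_maximal. Qed.

Let M0 y : (0 <= M y)%E.
Proof. exact: local_maximal_ge0. Qed.

Let phi0 N y : 0 <= phi N y.
Proof. exact: step_power_ge0. Qed.

Let mphi N : measurable_fun [set: borel S] (fun y : borel S => (phi N y)%:E).
Proof. exact: measurable_step_power. Qed.

Lemma int_local_maximal_le : (\int[mu]_(y in Q) M y <= W%:E * V)%E.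
Proof.
apply: le_trans (int_maximal_le x0 (ltW W0) AW R0).
apply: ge0_le_integral => //; first exact: measurable_funTS.
- by apply: measurable_funTS; exact: measurable_maximal_fun.
- by move=> y _; exact: local_maximal_le_maximal.
Qed.

Let X N := (\int[mu]_(y in Q) ((phi N y)%:E * M y))%E.

Let X_fin N : X N \is a fin_num.
Proof.
rewrite ge0_fin_numE; last by apply: integral_ge0 => y _; rewrite mule_ge0// lee_fin.
apply: (@le_lt_trans _ _ ((level l0 (3 / 2) N `^ e)%:E * (W%:E * V))%E); last first.
  by rewrite -(fineK Vfin) -!EFinM ltry.
apply: (@le_trans _ _ ((level l0 (3 / 2) N `^ e)%:E * \int[mu]_(y in Q) M y)%E); last first.
  by apply: lee_wpmul2l int_local_maximal_le; rewrite lee_fin powR_ge0.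
rewrite -ge0_integralZl_EFin ?powR_ge0//; last exact: measurable_funTS.
apply: ge0_le_integral => //.
- by move=> y _; rewrite mule_ge0// lee_fin.
- by apply: emeasurable_funM; exact: measurable_funTS.
- by apply: measurable_funeM; exact: measurable_funTS.
- by move=> y _; apply: lee_wpmul2r => //; rewrite lee_fin; exact: step_power_le.
Qed.

(** The self-improving step: the maximal function bounds its own higher
    integral, with a coefficient 1/2 that is absorbed because [X] is finite. *)
Let X_le N : (X N <= (2 * l0 `^ e * W)%:E * V)%E.
Proof.
have A0 : 0 <= 2 * P * W by rewrite !mulr_ge0// ltW.
have step : (X N <= (l0 `^ e)%:E * \int[mu]_(y in Q) M y
    + (2 * P * W * (e * (3 / 2)))%:E * X N)%E.
  apply: ge0_integral_step_power => // la lla.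
  have la0 : 0 < la by apply: lt_le_trans lla.
  apply: int_superlevel_le => //; first by rewrite mulr_ge0// ltW.
  have H := stopped_int_maximal_le la0 (level_hyp lla) W1 AW.
  by move=> b; exact: H.
have half : 2 * P * W * (e * (3 / 2)) = 1 / 2.
  have -> : 2 * P * W * (e * (3 / 2)) = 3 * (e * (P * W)) by field.
  by rewrite e_eq; field.
rewrite half in step.
have le0 : (0 <= (l0 `^ e)%:E)%E by rewrite lee_fin powR_ge0.
have := le_trans step (leeD2r _ (lee_wpmul2l le0 int_local_maximal_le)).
rewrite -(fineK (X_fin N)) -(fineK Vfin) -!EFinM -EFinD !lee_fin.
by lra.
Qed.

Let int_weight_phi_le N : (\int[mu]_(y in Q) ((phi N y)%:E * (w y)%:E)
    <= (3 / 2 * l0 `^ e)%:E * V)%E.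
Proof.
have step : (\int[mu]_(y in Q) ((phi N y)%:E * (w y)%:E)
    <= (l0 `^ e)%:E * V + (P * (e * (3 / 2)))%:E * X N)%E.
  apply: ge0_integral_step_power => //; first exact: ltW.
  move=> la lla; have la0 : 0 < la by apply: lt_le_trans lla.
  apply: int_superlevel_le => //; first by rewrite mulr_ge0// ltW.
  have H := stopped_int_weight_le la0 (level_hyp lla).
  by move=> b; exact: H.
apply: (le_trans step).
have Pe0 : (0 <= (P * (e * (3 / 2)))%:E)%E.
  by rewrite lee_fin !mulr_ge0// ltW.
apply: le_trans (leeD2l _ (lee_wpmul2l Pe0 (X_le N))) _.
rewrite -(fineK Vfin) -!EFinM -EFinD lee_fin.
have -> : P * (e * (3 / 2)) * (2 * l0 `^ e * W * fine V)
  = 3 * (e * (P * W)) * (l0 `^ e * fine V) by field.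
by rewrite e_eq; lra.
Qed.

Lemma exists_level_ge (x : R) : exists N, x <= level l0 (3 / 2) N.
Proof.
have gr N : N%:R / 2 <= (3 / 2) ^+ N :> R.
  elim: N => [|N IH]; first by rewrite mul0r.
  rewrite exprS; have : 1 <= (3 / 2) ^+ N :> R by rewrite exprn_ege1// ltW.
  by rewrite -[N.+1%:R]natr1; move: IH; lra.
have [x_le0|x_gt0] := leP x 0.
  by exists 0%N; rewrite (le_trans x_le0)// ltW// level_gt0.
exists (Num.bound (x / l0 * 2)).
rewrite /level -ler_pdivrMl// mulrC; apply: le_trans (gr _).
rewrite ler_pdivlMr//; apply/ltW/archi_boundP.
by rewrite !mulr_ge0// ?invr_ge0 ltW.
Qed.

(** On the part of B where w is at most the level N, [w `^ e] is almost everywhere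
    below the N-th truncated power of M; these parts increase to B. *)
Lemma int_weight_power_le :
  (\int[mu]_(y in qball d x0 r) (w y `^ (1 + e))%:E <= (3 / 2 * l0 `^ e)%:E * V)%E.
Proof.
pose B := qball d x0 r.
have mB : measurable (B : set (borel S)) by exact: measurable_qball.
pose F N : set (borel S) := B `&` [set y | w y <= level l0 (3 / 2) N].
have mF N : measurable (F N).
  have -> : F N = B `&` w @^-1` `]-oo, level l0 (3 / 2) N].
    by apply/seteqP; split => y /=; rewrite in_itv.
  by rewrite -[X in B `&` X]setTI; apply: measurableI => //; exact: mw.
have FU : \bigcup_N F N = B.
  apply/seteqP; split => [y [N _ []]//|y By].
  by have [N yN] := exists_level_ge (w y); exists N.
have mwe : measurable_fun [set: borel S] (fun y : borel S => (w y `^ (1 + e))%:E).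
  by apply/measurable_EFinP; exact: (measurableT_comp (@measurable_powR R (1 + e)) mw).
have -> : qball d x0 r = \bigcup_N F N by rewrite FU.
have ndF : {homo F : n m / (n <= m)%N >-> (n <= m)%O}.
  move=> n m nm; apply/subsetPset => y [By yn]; split => //.
  by apply: le_trans yn _; exact: level_le.
have cvgF := @ge0_nondecreasing_set_cvg_integral _ (borel S) R F
  (fun y => (w y `^ (1 + e))%:E) mu ndF mF
  (fun N => measurable_funTS mwe) (fun _ _ _ => powR_ge0 _ _).
apply: (cvge_to_le cvgF).
near=> N; apply: le_trans (int_weight_phi_le N).
apply: (@le_trans _ _ (\int[mu]_(y in F N) ((phi N y)%:E * (w y)%:E))%E); last first.
  apply: ge0_subset_integral => //.
  - by apply: emeasurable_funM; apply: measurable_funTS.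
  - by move=> y _; rewrite mule_ge0// lee_fin.
  - move=> y [By _]; apply: qball_le By.
    by rewrite ler_peMl ?(ltW r0)//; move: k1; lra.
apply: ae_ge0_le_integral => //.
- by move=> y _; rewrite lee_fin powR_ge0.
- exact: measurable_funTS.
- by move=> y _; rewrite mule_ge0// lee_fin.
- by apply: emeasurable_funM; apply: measurable_funTS.
apply: (ae_imply (T := borel S)) ae_le_local_maximal => y le_y [/le_y yM yN].
rewrite -EFinM lee_fin -mulr_powRB1 ?addr_gt0//.
rewrite [1 + e]addrC addrK mulrC ler_wpM2r//.
exact: powR_le_step_power.
Unshelve. all: by end_near. Qed.

Let average_QE : average mu Q (EFin \o w) = a%:E.
Proof.
rewrite /average -(fineK Qfin) inver gt_eqF ?fine_gt0 ?qball_gt0 ?qball_lty//.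
rewrite -[X in (_ * X)%E](fineK Vfin) -EFinM; congr (_%:E).
by rewrite /a mulrC.
Qed.

Let L0_le : L0 <= P.
Proof.
apply: powR_order_le; first by rewrite addr_ge0 ?mulr_ge0 ?sqr_ge0 ?(ltW k0).
have h1 : 1 <= theta ^+ 2.
  by rewrite exprn_ege1//; have := theta_ge; move: k1; lra.
have h2 := ler_wpM2l (sqr_ge0 kappa) h1.
have h3 : kappa <= kappa ^+ 2 by rewrite expr2 ler_peMl// ltW.
by rewrite -mulrA; move: h2 h3; have := sqr_ge0 kappa; lra.
Qed.

(** The constant in l0 costs little once raised to the power e: it is at most P
    and e is at most [1 / (6 * P)]. *)
Let l0_powR_le : l0 `^ e <= 7 / 6 * a `^ e.
Proof.
rewrite powRM ?(ltW a0) ?(ltW L0_gt0)// ler_wpM2r ?powR_ge0//.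
apply: le_trans (bernoulli_powR L0_gt0 e1) _.
have h1 : L0 <= P * W by apply: le_trans L0_le _; apply: ler_peMr => //; exact: ltW.
by have := ler_wpM2l (ltW e0) h1; rewrite e_eq; have := e0; lra.
Qed.

Lemma reverse_holder_estimate :
  (average mu (qball d x0 r) (fun y => (w y `^ (1 + e))%:E) `^ (1 + e)^-1
   <= (2 * (4 * kappa) `^ D)%:E * average mu Q (EFin \o w))%E.
Proof.
pose K := (4 * kappa) `^ D.
have K1 : 1 <= K.
  apply: (@le_trans _ _ (1 `^ D)); first by rewrite powR1.
  apply: ge0_ler_powR; rewrite ?nnegrE//; first exact: doubling_order_ge0.
    by rewrite mulr_ge0// ltW.
  by move: k1; lra.
have K0 : 0 < K by apply: lt_le_trans K1.
have p0 : 0 < 1 + e by rewrite addr_gt0.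
have Ka0 : 0 <= 2 * K * a by exact: mulr_ge0 (mulr_ge0 (ler0n _ 2) (ltW K0)) (ltW a0).
have average_le_Ka : (average mu (qball d x0 r) (fun y => (w y `^ (1 + e))%:E)
    <= ((2 * K * a) `^ (1 + e))%:E)%E.
  rewrite average_le//; apply: (le_trans int_weight_power_le).
  have -> : V = (a%:E * mu Q)%E.
    rewrite -(fineK Qfin) -EFinM /a divfK ?fineK//.
    by rewrite gt_eqF// fine_gt0// qball_gt0// qball_lty.
  have two_k1 : 1 <= 2 * kappa by move: k1; lra.
  have := mu_qball_dilate x0 r0 two_k1.
  have -> : 2 * (2 * kappa) = 4 * kappa by ring.
  have a0E : (0 <= a%:E)%E by rewrite lee_fin ltW.
  move=> /(lee_wpmul2l a0E) le_muQ.
  have c0 : (0 <= (3 / 2 * l0 `^ e)%:E)%E by rewrite lee_fin mulr_ge0// powR_ge0.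
  apply: le_trans (lee_wpmul2l c0 le_muQ) _.
  rewrite !muleA -!EFinM; apply: lee_wpmul2r => //; rewrite lee_fin -/K.
  have aK : 0 <= a * K by exact: mulr_ge0 (ltW a0) (ltW K0).
  have aK0 : 0 <= 3 / 2 * (a * K) by exact: mulr_ge0.
  apply: (@le_trans _ _ (2 * K * a `^ (1 + e))).
    have := ler_wpM2l aK0 l0_powR_le.
    have -> : a `^ (1 + e) = a * a `^ e.
      by rewrite powRD ?powRr1 ?(ltW a0)// (gt_eqF a0) implybT.
    have : 0 <= a * K * a `^ e by exact: mulr_ge0 aK (powR_ge0 _ _).
    by lra.
  rewrite [leRHS](powRM _ (mulr_ge0 (ler0n _ 2) (ltW K0)) (ltW a0)).
  by rewrite ler_wpM2r ?powR_ge0// le1r_powR//; [move: K1|move: e0]; lra.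
rewrite [X in (_ <= _ * X)%E](_ : _ = a%:E); last exact: average_QE.
rewrite -EFinM -/K.
apply: (@le_trans _ _ ((((2 * K * a) `^ (1 + e))%:E) `^ (1 + e)^-1)%E).
  apply: gt0_ler_poweR => //; first by rewrite invr_ge0 ltW.
  - rewrite in_itv/= leey andbT; apply: mule_ge0; first by rewrite inve_ge0.
    by apply: integral_ge0 => y _; rewrite lee_fin powR_ge0.
  - by rewrite in_itv/= leey andbT lee_fin powR_ge0.
by rewrite poweR_EFin -powRrM mulfV ?gt_eqF// powRr1.
Qed.

End Estimate.

(** The estimate for exponent 1, which is the one for an infinite constant. *)
Lemma average_dilate_le :
  (average mu (qball d x0 r) (EFin \o w)
   <= ((4 * kappa) `^ D)%:E * average mu Q (EFin \o w))%E.
Proof.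
have Vfin : V \is a fin_num.
  by rewrite ge0_fin_numE ?wloc//; apply: integral_ge0 => y _; rewrite lee_fin.
have v0 : 0 < fine (mu Q) by rewrite fine_gt0// qball_gt0//= qball_lty.
rewrite [X in (_ <= _ * X)%E]/average -(fineK (qball_fin x0 R0)) inver gt_eqF//.
rewrite -[X in (_ <= _ * (_ * X))%E](fineK Vfin) -!EFinM average_le//.
have BQ : qball d x0 r `<=` Q.
  by apply: qball_le; rewrite ler_peMl ?(ltW r0)//; move: k1; lra.
apply: le_trans (weight_int_le _ _ BQ) _; [exact: measurable_qball..|].
rewrite -(fineK Vfin).
have two_k1 : 1 <= 2 * kappa by move: k1; lra.
have := mu_qball_dilate x0 r0 two_k1.
rewrite -(fineK (qball_fin x0 R0)) -(fineK (qball_fin x0 r0)) -!EFinM !lee_fin.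
have -> : 2 * (2 * kappa) = 4 * kappa by ring.
set K := _ `^ D => le_mu.
have VQ0 : 0 <= fine V / fine (mu Q).
  by rewrite divr_ge0 ?fine_ge0//; apply: integral_ge0 => y _; rewrite lee_fin.
have := ler_wpM2l VQ0 le_mu; rewrite divfK ?gt_eqF//.
by rewrite [_^-1 * _]mulrC mulrAC mulrA [K * _]mulrC -!mulrA.
Qed.

Lemma average_powR_eq0 p : 0 < p -> V = 0%E ->
  average mu (qball d x0 r) (fun y => (w y `^ p)%:E) = 0%E.
Proof.
move=> p0 V0.
have mQ : measurable (Q : set (borel S)) by exact: measurable_qball.
have mB : measurable (qball d x0 r : set (borel S)) by exact: measurable_qball.
have BQ : qball d x0 r `<=` Q.
  by apply: qball_le; rewrite ler_peMl ?(ltW r0)//; move: k1; lra.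
have : ae_eq mu Q (fun y => (w y)%:E) (cst 0%E).
  apply/ae_eq_integral_abs => //; first exact: measurable_funTS.
  by rewrite -[RHS]V0; apply: eq_integral => y _; rewrite gee0_abs.
move=> w_ae0; rewrite /average.
rewrite (_ : integral _ _ _ = 0%E) ?mule0//.
rewrite -(integral0 mu (qball d x0 r)); apply: ge0_ae_eq_integral => //.
- apply: measurable_funTS; apply/measurable_EFinP.
  exact: (measurableT_comp (@measurable_powR R p) mw).
- by move=> y _; rewrite lee_fin powR_ge0.
apply: (ae_imply (T := borel S)) w_ae0 => y wy0 By.
have wy : w y = 0 by apply: EFin_inj; exact: (wy0 (BQ _ By)).
rewrite /= wy.
by rewrite powR0// gt_eqF.
Qed.

End LocalBall.
End Weight.

(** An infinite average of w would make the product in [Ap_const] infinite, even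
    against a vanishing factor. *)
Lemma Ap_locally_integrable (p : R) (w : S -> R) : Ap d mu p w ->
  forall x s, 0 < s -> (\int[mu]_(y in qball d x s) (w y)%:E < +oo)%E.
Proof.
move=> [[w0 _] Apw] x s s0; rewrite ltey; apply/eqP => wy.
move: Apw; apply/negP; rewrite -leNgt; apply: ereal_sup_ubound.
exists x, s; split => //.
have -> : average mu (qball d x s) (EFin \o w) = +oo%E.
  rewrite /average wy -(fineK (qball_fin x s0)) inver.
  have v0 : 0 < fine (mu (qball d x s)) by rewrite fine_gt0// qball_gt0//= qball_lty.
  by rewrite gt_eqF// gt0_muley// lte_fin invr_gt0.
set u := (_ `^ _)%E; have u0 : (0 <= u)%E by exact: poweR_ge0.
rewrite /mul0y eqxx /=; case: (eqVneq u 0%E) => [_|un0] //=.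
by rewrite gt0_mulye// lt_neqAle eq_sym un0.
Qed.

End Homogeneous.

Theorem theorem1p1 (R : realType) (S : ptopologicalType)
    (d : S -> S -> R) (kappa : R) (mu : {measure set (borel S) -> \bar R})
    (w : S -> R) :
  is_homogeneous_type kappa d mu ->
  standing_assumptions d mu ->
  Ainfty d mu w ->
  forall (x : S) (r : R), 0 < r ->
    ((average mu (qball d x r)
        (fun y => (w y `^ rh_exponent d mu kappa w)%:E))
       `^ (rh_exponent d mu kappa w)^-1
     <= (2 * (4 * kappa) `^ doubling_order d mu)%:E
        * average mu (qball d x (2 * kappa * r)) (EFin \o w))%E.
Proof.
move=> Hh Hs [p _ Apw] x r r0; have [[w0 mw] _] := Apw.
have wloc := Ap_locally_integrable Hs Apw.
set Q := qball d x (2 * kappa * r).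
have V_ge0 : (0 <= \int[mu]_(y in Q) (w y)%:E)%E.
  by apply: integral_ge0 => y _; rewrite lee_fin.
have av_ge0 : (0 <= average mu Q (EFin \o w))%E.
  by rewrite mule_ge0// inve_ge0.
have K0 : 0 <= (4 * kappa) `^ doubling_order d mu by exact: powR_ge0.
have tau0 : 0 < tau d mu kappa.
  have k0 : 0 < kappa by exact: lt_le_trans ltr01 (kappa_ge1 Hh).
  have th0 : 0 < 4 * kappa ^+ 2 + kappa by rewrite addr_gt0// mulr_gt0// exprn_gt0.
  by rewrite mulr_gt0// powR_gt0// mulr_gt0 ?exprn_gt0// mulr_gt0 ?exprn_gt0.
have Ainf0 : (0 <= Ainfty_const d mu w)%E.
  apply: le_ereal_sup_tmp; eexists; first by exists x, r.
  rewrite mule_ge0 ?inve_ge0//; apply: integral_ge0 => y _.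
    by rewrite lee_fin.
  exact: (maximal_fun_ge0 Hh).
have [V0|Vn0] := eqVneq (\int[mu]_(y in Q) (w y)%:E)%E 0%E.
  have rh1 : 0 < rh_exponent d mu kappa w.
    rewrite ltr_pwDl// fine_ge0// inve_ge0 mule_ge0// lee_fin; exact: ltW.
  rewrite (average_powR_eq0 Hh Hs w0 mw r0)//.
  rewrite poweR0r; last by rewrite invr_eq0 gt_eqF.
  by rewrite mule_ge0// lee_fin mulr_ge0.
have Vpos : (0 < \int[mu]_(y in Q) (w y)%:E)%E by rewrite lt_neqAle eq_sym Vn0.
have := Ainfty_const_ge1 Hh Hs w0 mw wloc r0 Vpos.
rewrite /rh_exponent; case AW : (Ainfty_const d mu w) => [W| |]// W1.
  have W1' : 1 <= W by rewrite -lee_fin.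
  have tW0 : 0 < tau d mu kappa * W by rewrite mulr_gt0// (lt_le_trans ltr01).
  rewrite -EFinM inver gt_eqF//=.
  apply: reverse_holder_estimate => //.
  by rewrite AW.
rewrite gt0_muley ?lte_fin// invey /= addr0 invr1.
under eq_fun do rewrite powRr1//.
rewrite poweRe1; last first.
  rewrite mule_ge0 ?inve_ge0//.
  by apply: integral_ge0 => y _; rewrite lee_fin.
apply: le_trans (average_dilate_le Hh Hs w0 mw wloc _ r0) _.
by apply: lee_wpmul2r => //; rewrite lee_fin ler_peMl// ler1n.
Qed.
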